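(* For every $\epsilon>0$ there exists $\delta>0$ such that the following holds. For every positive integer $n$, if $G$ is a string graph with $n$ vertices and at most $(\frac{1}{4}-\epsilon)\frac{n^{2}}{2}$ edges, then there exist two disjoint sets $A,B\subset V(G)$ such that $|A|=|B|\geq \delta n$ and there are no edges of $G$ between $A$ and $B$.
   Context: A curve in the plane is the image of a continuous function $\phi:[0,1]\rightarrow\mathbb{R}^{2}$. The intersection graph of a family of sets $\mathcal{C}$ is the graph whose vertices are the elements of $\mathcal{C}$, two vertices being adjacent if the corresponding sets have nonempty intersection. A string graph is the intersection graph of a finite family of curves in the plane.
   Formalization: The formal theorem assumes n ≥ 2 instead of n positive: for n = 1 and ε ≤ 1/4 the one-vertex string graph meets the edge bound, but disjoint sets A, B of equal size are empty, so |A| ≥ δn fails. *)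

(* Defs.v *)
From HB Require Import structures.
From mathcomp Require Import all_boot all_order all_algebra.
From mathcomp Require Import all_classical all_reals all_analysis.
Set Implicit Arguments.
Unset Strict Implicit.
Unset Printing Implicit Defensive.
Import Order.TTheory GRing.Theory Num.Theory.
Import numFieldNormedType.Exports.
Local Open Scope classical_set_scope.
Local Open Scope ring_scope.

Record sgraph : Type := SGraph {
  vertex : finType;
  adj : rel vertex;
  adj_sym : symmetric adj;
  adj_irr : irreflexive adj
}.

Definition edges (G : sgraph) : {set {set vertex G}} :=
  [set [set p.1; p.2]%SET | p : vertex G * vertex G & adj p.1 p.2]%SET.

Definition no_edges_between (G : sgraph) (A B : {set vertex G}) : Prop :=
  forall a b : vertex G, a \in A -> b \in B -> ~~ adj a b.

(* Only the restriction of [phi] to [0, 1] matters: continuity is required for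
   the subspace topology of the unit interval. *)
Definition is_curve (R : realType) (C : set (R * R)) : Prop :=
  exists phi : R -> R * R,
    {within `[0, 1], continuous phi} /\ C = phi @` `[0, 1].

(* The family is indexed by the vertices, so two vertices may carry the same
   set; they are then adjacent as soon as that set is nonempty. *)
Definition is_intersection_graph (X : Type) (G : sgraph)
    (F : vertex G -> set X) : Prop :=
  forall x y : vertex G, x != y -> (adj x y <-> F x `&` F y !=set0).

Definition string_graph (R : realType) (G : sgraph) : Prop :=
  exists F : vertex G -> set (R * R),
    (forall v, is_curve (F v)) /\ is_intersection_graph F.

(* Main.v *)
(* Suppose that no two linear-size sets of curves are far apart. After passing to
   a linear-size set of vertices with all degrees at most (1/4 - eps) times its
   size, choose five spread-out probability measures on it minimizing, up to a
   tiny loss even at much smaller scales, the total edge density between them.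
   Exchanging one measure with the uniform one shows that the densities from
   each measure to the four others add up to less than 1, and this remains true
   after restriction to sets of positive measure. In particular, for any two of
   the measures, adjacent typical vertices leave room in each of the other
   three, so that one can greedily find five pairwise disjoint curves and ten
   paths joining them such that paths joining disjoint pairs do not meet. This
   contradicts the strong nonplanarity of K5, proved by counting crossings of
   polygonal approximations modulo 2.

   The greedy step needs a vertex of large degree in every set of positive
   measure. If all degrees were small, one could fix a connected set X whose
   neighbourhood has small positive measure; almost every curve is reached from X
   in two steps, and four such paths never dominate everything. Removing the
   neighbourhood of four paths leaves one giant component, and a Sperner type
   argument with winding numbers on a fine grid shows that such a choice of
   components is impossible in the plane. *)

Require Import Defs.
From HB Require Import structures.
From mathcomp Require Import all_boot all_order all_algebra.
From mathcomp Require Import all_classical all_reals all_analysis.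
From mathcomp Require Import zify ring lra.
Set Implicit Arguments.
Unset Strict Implicit.
Unset Printing Implicit Defensive.
Import Order.TTheory GRing.Theory Num.Theory.
Import numFieldNormedType.Exports.
Local Open Scope ring_scope.

(** * Segments and polygonal chains *)

Section Segments.
Variable R : realFieldType.
Implicit Types (u v p q z : R * R) (s : seq (R * R)).

(* The lexicographic order is the order of abscissas after an infinitesimal
   rotation; it makes general position assumptions unnecessary. *)
Definition ltl u v := (u.1 < v.1) || ((u.1 == v.1) && (u.2 < v.2)).

Definition orient p q u := (q.1 - p.1) * (u.2 - p.2) - (q.2 - p.2) * (u.1 - p.1).

(* After the infinitesimal rotation: the upward ray from [u] crosses the
   segment [p q]. *)
Definition ray u p q :=
  (ltl p u && ltl u q && (orient p q u < 0))
  || (ltl q u && ltl u p && (orient q p u < 0)).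

Definition on_seg z p q := exists2 t : R, 0 <= t <= 1 &
  z = (p.1 + t * (q.1 - p.1), p.2 + t * (q.2 - p.2)).

Definition seg_disj p q u v := forall z, on_seg z p q -> on_seg z u v -> False.

Lemma rayC u p q : ray u p q = ray u q p.
Proof. by rewrite /ray orbC. Qed.

Lemma ltl_irr u : ltl u u = false.
Proof. by rewrite /ltl !ltxx andbF. Qed.

Lemma ltl_trans : transitive ltl.
Proof.
move=> [a b] [c d] [e f]; rewrite /ltl /=.
move=> /orP[h1|/andP[/eqP-> h1]] /orP[h2|/andP[/eqP<- h2]]; apply/orP.
- by left; apply: lt_trans h2.
- by left.
- by left.
- by right; rewrite eqxx (lt_trans h1).
Qed.

Lemma ltl_asym u v : ltl u v -> ltl v u = false.
Proof. by move=> h; apply/negP => /(ltl_trans h); rewrite ltl_irr. Qed.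

Lemma ltl_total u v : u <> v -> ltl u v = ~~ ltl v u.
Proof.
case: u v => [a b] [c d] ne; rewrite /ltl /=.
case: (ltgtP a c) => //= ac; case: (ltgtP b d) => //= bd.
by case: ne; rewrite ac bd.
Qed.

Lemma on_segl p q : on_seg p p q.
Proof. by exists 0; rewrite ?lexx ?ler01 // !mul0r !addr0; case: p. Qed.

Lemma on_segr p q : on_seg q p q.
Proof.
exists 1; rewrite ?lexx ?ler01 // !mul1r.
by case: p q => [a b] [c d] /=; congr (_, _); ring.
Qed.

Lemma on_segC z p q : on_seg z p q -> on_seg z q p.
Proof.
case=> t /andP[t0 t1] ->; exists (1 - t); first by apply/andP; split; lra.
by congr (_, _) => /=; ring.
Qed.

Lemma seg_disjC p q u v : seg_disj p q u v -> seg_disj u v p q.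
Proof. by move=> h z ? ?; apply: (h z). Qed.

Lemma seg_disjl p q u v : seg_disj p q u v -> seg_disj q p u v.
Proof. by move=> h z /on_segC ? ?; apply: (h z). Qed.

Lemma seg_disjr p q u v : seg_disj p q u v -> seg_disj p q v u.
Proof. by move=> h z ? /on_segC ?; apply: (h z). Qed.

(** All small positive slopes [t] realize the infinitesimal rotation on a given pair, so finitely
    many comparisons share one linear functional. *)
Lemma ltl_tilt u v : ltl u v -> exists2 e : R, 0 < e &
  forall t, 0 < t < e -> u.1 + t * u.2 < v.1 + t * v.2.
Proof.
case: u v => [a b] [c d]; rewrite /ltl /= => /orP[ac|/andP[/eqP-> bd]]; last first.
  by exists 1 => // t /andP[t0 _]; rewrite ltrD2l ltr_pM2l.
exists ((c - a) / (`|b - d| + 1)).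
  by rewrite divr_gt0 ?subr_gt0 // ltr_wpDl.
have dp : 0 < `|b - d| + 1 by rewrite ltr_wpDl.
move=> t /andP[t0]; rewrite ltr_pdivlMr // => h.
have := ler_norm (b - d); nra.
Qed.

Lemma ltl_tilt3 u v p q : ltl u v -> ltl v p -> ltl p q -> exists t : R,
  [/\ u.1 + t * u.2 < v.1 + t * v.2, v.1 + t * v.2 < p.1 + t * p.2 &
      p.1 + t * p.2 < q.1 + t * q.2].
Proof.
move=> /ltl_tilt[a a0 ha] /ltl_tilt[b b0 hb] /ltl_tilt[c c0 hc].
have m0 : 0 < Num.min a (Num.min b c) by rewrite !lt_min a0 b0 c0.
have := midf_lt m0; rewrite add0r => -[t0].
rewrite !lt_min => /andP[ta /andP[tb tc]].
by exists (Num.min a (Num.min b c) / 2); split; [apply: ha|apply: hb|apply: hc];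
  rewrite ?ta ?tb ?tc t0.
Qed.

(** Divided by [a + b], the two weighted sums become one point, lying on both segments. *)
Lemma seg_meet (u v p q : R * R) (a b c d : R) :
  0 <= a -> 0 <= b -> 0 <= c -> 0 <= d -> 0 < a + b -> a + b = c + d ->
  a * q.1 + b * p.1 = c * v.1 + d * u.1 ->
  a * q.2 + b * p.2 = c * v.2 + d * u.2 ->
  seg_disj u v p q -> False.
Proof.
move=> a0 b0 c0 d0 ab abcd e1 e2 sd.
have ne : a + b != 0 by rewrite gt_eqF.
have quot x : 0 <= x -> x <= a + b -> 0 <= x / (a + b) <= 1.
  by move=> x0 xab; rewrite divr_ge0 ?(ltW ab) //= ler_pdivrMr // mul1r.
apply: (sd (u.1 + c / (a + b) * (v.1 - u.1), u.2 + c / (a + b) * (v.2 - u.2))).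
  by exists (c / (a + b)) => //; apply: quot; lra.
exists (a / (a + b)); first by apply: quot; lra.
congr (_, _); apply: (mulfI ne).
- transitivity (a * q.1 + b * p.1); last by field.
  rewrite e1; transitivity (c * v.1 + (a + b - c) * u.1); last by rewrite abcd; ring.
  by field.
- transitivity (a * q.2 + b * p.2); last by field.
  by rewrite e2 -(addKr c d) -abcd; field.
Qed.

(** Together with the next two lemmas this is Cramer's rule: four points of the plane are affinely
    dependent, with signed orientations of their triples as coefficients. *)
Lemma orient_sum u v p q :
  orient u v p + orient p q u = orient u v q + orient p q v.
Proof. by rewrite /orient; ring. Qed.

Lemma orient_dep1 u v p q :
  orient p q v * u.1 - orient p q u * v.1 + orient u v q * p.1
    - orient u v p * q.1 = 0.
Proof. by rewrite /orient; ring. Qed.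

Lemma orient_dep2 u v p q :
  orient p q v * u.2 - orient p q u * v.2 + orient u v q * p.2
    - orient u v p * q.2 = 0.
Proof. by rewrite /orient; ring. Qed.

Lemma ltl_le1 u v : ltl u v -> u.1 <= v.1.
Proof. by case/orP => [/ltW//|/andP[/eqP->]]. Qed.

Lemma ltl_vert u v : ltl u v -> u.1 = v.1 -> u.2 < v.2.
Proof. by rewrite /ltl => + e; rewrite e ltxx eqxx. Qed.

Lemma ltl_collinear u v p : ltl u p -> ltl p v -> orient u v p = 0 -> on_seg p u v.
Proof.
move=> up pv; rewrite /orient => e.
have [h1 h2] := (ltl_le1 up, ltl_le1 pv).
have [uv|nuv] := eqVneq u.1 v.1.
  have up1 : u.1 = p.1 by lra.
  have up2 := ltl_vert up up1.
  have pv2 : p.2 < v.2 by apply: ltl_vert pv _; rewrite -up1.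
  have uv2 : v.2 - u.2 != 0 by lra.
  exists ((p.2 - u.2) / (v.2 - u.2)).
    by rewrite divr_ge0 ?ler_pdivrMr ?mul1r //=; lra.
  rewrite -uv subrr mulr0 addr0 up1 divfK // addrC subrK.
  by case: (p).
have uv1 : v.1 - u.1 != 0 by rewrite subr_eq0 eq_sym.
have uv : u.1 < v.1 by rewrite lt_neqAle nuv (le_trans h1 h2).
exists ((p.1 - u.1) / (v.1 - u.1)).
  by rewrite divr_ge0 ?ler_pdivrMr ?mul1r //=; lra.
rewrite divfK // [RHS](_ : _ = (p.1, p.2)); first by case: (p).
congr (_, _); first by rewrite addrC subrK.
apply: (mulfI uv1).
transitivity ((v.1 - u.1) * u.2 + (v.2 - u.2) * (p.1 - u.1)); first by field.
by nra.
Qed.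

Lemma tilt_dep (u v p q : R * R) (a b c d t : R) :
  d * u.1 - c * v.1 + b * p.1 - a * q.1 = 0 ->
  d * u.2 - c * v.2 + b * p.2 - a * q.2 = 0 ->
  d * (u.1 + t * u.2) - c * (v.1 + t * v.2) + b * (p.1 + t * p.2)
     - a * (q.1 + t * q.2) = 0.
Proof.
move=> e1 e2; rewrite -[RHS]addr0 -{1}e1 -[X in _ = _ + X](mulr0 t) -e2.
by ring.
Qed.

(* [a] and [d] are, up to a common sign, the orientations of [u v p] and
   [p q v]; the hypotheses on [a b c d] are the affine dependency of the four
   points. *)
Lemma interleaved_meet (u v p q : R * R) (a b c d : R) :
  ltl u p -> ltl p v -> ltl v q -> a + c = b + d ->
  d * u.1 - c * v.1 + b * p.1 - a * q.1 = 0 ->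
  d * u.2 - c * v.2 + b * p.2 - a * q.2 = 0 ->
  seg_disj u v p q -> a < 0 -> d < 0 -> False.
Proof.
move=> up pv vq s e1 e2 sd a0 d0.
have [b0|b0] := leP 0 b; have [c0|c0] := leP 0 c.
- by apply: (@seg_meet u v p q (- a) b c (- d)) => //; lra.
- have [t [h1 h2 h3]] := ltl_tilt3 up pv vq.
  have et := tilt_dep t e1 e2.
  move: (_ + t * u.2) (_ + t * v.2) (_ + t * p.2) (_ + t * q.2) h1 h2 h3 et
    => U V P Q h1 h2 h3 et; nra.
- have [t [h1 h2 h3]] := ltl_tilt3 up pv vq.
  have et := tilt_dep t e1 e2.
  move: (_ + t * u.2) (_ + t * v.2) (_ + t * p.2) (_ + t * q.2) h1 h2 h3 et
    => U V P Q h1 h2 h3 et; nra.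
- have [t [h1 h2 h3]] := ltl_tilt3 up pv vq.
  have et := tilt_dep t e1 e2.
  move: (_ + t * u.2) (_ + t * v.2) (_ + t * p.2) (_ + t * q.2) h1 h2 h3 et
    => U V P Q h1 h2 h3 et; nra.
Qed.

(** Here [p] and [q] are on opposite sides of the line [u v]. The dependency then yields a common
    point, or its signs contradict the order of the tilted abscissas or the relation between the
    coefficients. *)
Lemma nested_meet (u v p q : R * R) (a b c d : R) :
  ltl u p -> ltl p q -> ltl q v -> a + c = b + d ->
  d * u.1 - c * v.1 + b * p.1 - a * q.1 = 0 ->
  d * u.2 - c * v.2 + b * p.2 - a * q.2 = 0 ->
  seg_disj u v p q -> a < 0 -> 0 < b -> False.
Proof.
move=> up pq qv s e1 e2 sd a0 b0.
have [c0|c0] := leP 0 c; have [d0|d0] := leP d 0.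
- by apply: (@seg_meet u v p q (- a) b c (- d)) => //; lra.
- have [t [h1 h2 h3]] := ltl_tilt3 up pq qv.
  have et := tilt_dep t e1 e2.
  move: (_ + t * u.2) (_ + t * v.2) (_ + t * p.2) (_ + t * q.2) h1 h2 h3 et
    => U V P Q h1 h2 h3 et; nra.
- have [t [h1 h2 h3]] := ltl_tilt3 up pq qv.
  have et := tilt_dep t e1 e2.
  move: (_ + t * u.2) (_ + t * v.2) (_ + t * p.2) (_ + t * q.2) h1 h2 h3 et
    => U V P Q h1 h2 h3 et; nra.
- lra.
Qed.

End Segments.

(** * Parity of crossings of polygonal chains *)

Section Crossings.
Variable R : realFieldType.
Implicit Types (u v p q z : R * R) (s : seq (R * R)).

Lemma ray_same u p : ray u p p = false.
Proof. by rewrite /ray; case: (boolP (ltl p u)) => [/ltl_asym ->|]; rewrite ?andbF. Qed.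

Lemma orient_neq0 u v p : ltl u p -> ltl p v -> ~ on_seg p u v ->
  orient u v p != 0.
Proof. by move=> up pv np; apply/eqP => /(ltl_collinear up pv). Qed.

(** Three orders remain. In the order [u v p q] every term vanishes; for [u p q v] and [u p v q] a
    failure of the identity produces the signs excluded by [nested_meet] and [interleaved_meet]. *)
Lemma seg_parity_sorted u v p q : ltl u v -> ltl p q -> ltl u p ->
  seg_disj u v p q ->
  ray u p q (+) ray v p q =
    (ray p u v (+) ltl p u (+) ltl p v) (+) (ray q u v (+) ltl q u (+) ltl q v).
Proof.
move=> uv pq up sd.
have uq := ltl_trans up pq.
have -> : ray u p q = false by rewrite /ray (ltl_asym up) (ltl_asym uq).
rewrite (ltl_asym up) (ltl_asym uq) /=.
have nvp : v <> p by move=> e; apply: (sd v (on_segr _ _)); rewrite e; exact: on_segl.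
have nvq : v <> q by move=> e; apply: (sd v (on_segr _ _)); rewrite e; exact: on_segr.
have np : ~ on_seg p u v by move=> /sd; apply; exact: on_segl.
have nq : ~ on_seg q u v by move=> /sd; apply; exact: on_segr.
have nv : ~ on_seg v p q by move=> h; apply: (sd _ (on_segr _ _) h).
have s := orient_sum u v p q.
have e1 := orient_dep1 u v p q; have e2 := orient_dep2 u v p q.
have [vp|pv] := boolP (ltl v p).
  have vq := ltl_trans vp pq.
  by rewrite /ray (ltl_asym vp) (ltl_asym vq) (ltl_asym up) (ltl_asym uq) /= !andbF.
have {pv} pv : ltl p v by rewrite (ltl_total (nesym nvp)).
rewrite pv.
have [qv|vq] := boolP (ltl q v).
  rewrite /ray pv qv uq up (ltl_asym pv) (ltl_asym uq) (ltl_asym up) (ltl_asym qv).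
  rewrite !andbF !orbF /=.
  have := orient_neq0 up pv np; have := orient_neq0 uq qv nq.
  move: s e1 e2; set a := orient u v p; set b := orient u v q.
  set c := orient p q u; set d := orient p q v => s e1 e2.
  rewrite !neq_lt => hb ha.
  case/orP: ha => ha; case/orP: hb => hb; rewrite ?ha ?hb ?(lt_gtF ha) ?(lt_gtF hb) //.
  - by case: (nested_meet up pq qv s e1 e2 sd ha hb).
  - by case: (nested_meet (a := - a) (b := - b) (c := - c) (d := - d) up pq qv _ _ _ sd); lra.
have {}vq : ltl v q by rewrite (ltl_total nvq).
rewrite /ray pv vq up (ltl_asym pv) (ltl_asym vq) (ltl_asym up) (ltl_asym uq).
rewrite !andbF !orbF /=.
have := orient_neq0 up pv np; have := orient_neq0 pv vq nv.
move: s e1 e2; set a := orient u v p; set b := orient u v q.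
set c := orient p q u; set d := orient p q v => s e1 e2.
rewrite !neq_lt => hd ha.
case/orP: ha => ha; case/orP: hd => hd; rewrite ?ha ?hd ?(lt_gtF ha) ?(lt_gtF hd) //.
- by case: (interleaved_meet up pv vq s e1 e2 sd ha hd).
- by case: (interleaved_meet (a := - a) (b := - b) (c := - c) (d := - d) up pv vq _ _ _ sd); lra.
Qed.

(** For [p] off the segment, this says whether the downward ray from [p] crosses it: if [p] is
    between [u] and [v], exactly one of the two vertical rays does. *)
Definition turn u v p := ray p u v (+) ltl p u (+) ltl p v.

(* Whether two segments cross is decided by their relative position at the two
   ends of the common abscissa range; each of these ends is an endpoint of one
   of the segments, and the order terms record which ones occur. *)
Lemma seg_parity u v p q : seg_disj u v p q ->
  ray u p q (+) ray v p q = turn u v p (+) turn u v q.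
Proof.
rewrite /turn.
have lt_dec (a b : R * R) : a <> b -> ltl a b \/ ltl b a.
  by move=> /ltl_total ->; case: (ltl b a); [right|left].
have wlog_pq : forall u v p q, ltl u v -> ltl p q -> seg_disj u v p q ->
  ray u p q (+) ray v p q =
    (ray p u v (+) ltl p u (+) ltl p v) (+) (ray q u v (+) ltl q u (+) ltl q v).
  move=> {}u {}v {}p {}q uv pq sd.
  have nup : u <> p by move=> e; apply: (sd u (on_segl _ _)); rewrite e; exact: on_segl.
  have nuq : u <> q by move=> e; apply: (sd u (on_segl _ _)); rewrite e; exact: on_segr.
  have nvp : v <> p by move=> e; apply: (sd v (on_segr _ _)); rewrite e; exact: on_segl.
  have nvq : v <> q by move=> e; apply: (sd v (on_segr _ _)); rewrite e; exact: on_segr.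
  case: (lt_dec _ _ nup) => [up|pu]; first exact: seg_parity_sorted.
  have := seg_parity_sorted pq uv pu (seg_disjC sd).
  rewrite (ltl_total nup) (ltl_total nuq) (ltl_total nvp) (ltl_total nvq).
  by case: (ray u p q); case: (ray v p q); case: (ray p u v); case: (ray q u v);
     case: (ltl p u); case: (ltl q u); case: (ltl p v); case: (ltl q v).
move=> sd.
have wlog_p : forall u v, ltl u v -> seg_disj u v p q ->
  ray u p q (+) ray v p q =
    (ray p u v (+) ltl p u (+) ltl p v) (+) (ray q u v (+) ltl q u (+) ltl q v).
  move=> {sd}u {}v uv sd.
  have [->|/eqP npq] := eqVneq p q.
    by rewrite !ray_same !addbb.
  case: (lt_dec _ _ npq) => pq; first exact: wlog_pq.
  by rewrite ![ray _ p q]rayC (wlog_pq _ _ _ _ uv pq (seg_disjr sd)) addbC.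
have [->|/eqP nuv] := eqVneq u v.
  by rewrite !ray_same !addbb.
case: (lt_dec _ _ nuv) => uv; first exact: wlog_p.
rewrite addbC (wlog_p _ _ uv (seg_disjl sd)) ![ray _ v u]rayC.
by congr (_ (+) _); rewrite addbAC.
Qed.

Fixpoint crossings u p s :=
  if s is q :: s' then ray u p q (+) crossings u q s' else false.

Fixpoint all_segs (P : R * R -> R * R -> Prop) p s :=
  if s is q :: s' then P p q /\ all_segs P q s' else True.

Lemma all_segs_cat P p s s' :
  all_segs P p s -> all_segs P (last p s) s' -> all_segs P p (s ++ s').
Proof. by elim: s p => //= q s IH p [? ?] ?; split; last exact: IH. Qed.

Lemma all_segs_impl P P' p s : (forall x y, P x y -> P' x y) ->
  all_segs P p s -> all_segs P' p s.
Proof. by move=> h; elim: s p => //= q s IH p [? ?]; split; auto. Qed.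

Lemma crossings_turn u v p s : all_segs (seg_disj u v) p s ->
  crossings u p s (+) crossings v p s = turn u v p (+) turn u v (last p s).
Proof.
elim: s p => [|q s IH] p /=; first by rewrite !addbb.
case=> /seg_parity h /IH {IH}.
move: h; case: (ray u p q); case: (ray v p q); case: (crossings u q s);
 by case: (crossings v q s); case: (turn u v p); case: (turn u v q);
   case: (turn u v _).
Qed.

(** For disjoint chains the terms of all interior vertices cancel, leaving the vertical rays from
    the four ends. Each pair of independent edges of K5 contributes one such relation. *)
Lemma crossings_sym a s c t : all_segs (fun u v => all_segs (seg_disj u v) c t) a s ->
  crossings a c t (+) crossings (last a s) c t =
  (crossings c a s (+) ltl c a (+) ltl c (last a s)) (+)
  (crossings (last c t) a s (+) ltl (last c t) a (+) ltl (last c t) (last a s)).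
Proof.
elim: s a => [|b s IH] a /=.
  by case: (crossings a c t); case: (ltl c a); case: (ltl (last c t) a).
case=> /crossings_turn + /IH {IH}; rewrite /turn.
move: (last b s) (last c t) => e d h1 h2.
have -> : crossings a c t (+) crossings e c t =
    (crossings a c t (+) crossings b c t) (+) (crossings b c t (+) crossings e c t).
  by case: (crossings a c t); case: (crossings b c t); case: (crossings e c t).
rewrite {}h1 {}h2.
case: (crossings c b s); case: (crossings d b s); case: (ltl c b); case: (ltl d b);
 by case: (ltl c a); case: (ltl c e); case: (ltl d a); case: (ltl d e);
    case: (ray c a b); case: (ray d a b).
Qed.

End Crossings.

(** * Strong nonplanarity of K5 *)

Section CompleteGraph.
Variable R : realFieldType.
Implicit Types (u v p q z : R * R) (s : seq (R * R)).

Definition indep (i j k l : nat) := [&& i != k, i != l, j != k & j != l].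

(** Moves a parity relation to the natural numbers, where [lia] can combine all 15 of them. *)
Lemma addb_even (a b c d e f g h : bool) : a (+) b = (c (+) d (+) e) (+) (f (+) g (+) h) ->
  exists k, (a + b + c + d + e + f + g + h = k.*2)%N.
Proof.
move=> e1; exists (a + b + c + d + e + f + g + h)./2.
rewrite -[LHS]odd_double_half !oddD !oddb e1.
by case: c {e1}; case: d; case: e; case: f; case: g; case: h.
Qed.

(* Summed over the 15 pairs of independent edges of K5, every crossing number
   of a vertex with an edge occurs twice, while the order terms add up to one
   for each of the five quadruples of vertices. *)
Lemma K5_parity (x : nat -> nat -> nat -> nat) (c : nat -> nat -> nat) :
  (forall i j k l, (i < j < 5)%N -> (k < l < 5)%N -> indep i j k l ->
     exists m, (x i k l + x j k l + x k i j + c k i + c k j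
                + x l i j + c l i + c l j = m.*2)%N) ->
  (forall i j, (i < j < 5)%N -> (c i j + c j i = 1)%N) -> False.
Proof.
move=> E C.
have [k0 e0] := E 0 1 2 3 isT isT isT.
have [k1 e1] := E 0 1 2 4 isT isT isT.
have [k2 e2] := E 0 1 3 4 isT isT isT.
have [k3 e3] := E 0 2 1 3 isT isT isT.
have [k4 e4] := E 0 2 1 4 isT isT isT.
have [k5 e5] := E 0 2 3 4 isT isT isT.
have [k6 e6] := E 0 3 1 2 isT isT isT.
have [k7 e7] := E 0 3 1 4 isT isT isT.
have [k8 e8] := E 0 3 2 4 isT isT isT.
have [k9 e9] := E 0 4 1 2 isT isT isT.
have [k10 e10] := E 0 4 1 3 isT isT isT.
have [k11 e11] := E 0 4 2 3 isT isT isT.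
have [k12 e12] := E 1 2 3 4 isT isT isT.
have [k13 e13] := E 1 3 2 4 isT isT isT.
have [k14 e14] := E 1 4 2 3 isT isT isT.
have c01 := C 0 1 isT.
have c02 := C 0 2 isT.
have c03 := C 0 3 isT.
have c04 := C 0 4 isT.
have c12 := C 1 2 isT.
have c13 := C 1 3 isT.
have c14 := C 1 4 isT.
have c23 := C 2 3 isT.
have c24 := C 2 4 isT.
have c34 := C 3 4 isT.
clear E C; lia.
Qed.

(** Chains with a common end may also meet elsewhere: only independent pairs enter the parity
    count. *)
Lemma K5_nonplanar (P : nat -> R * R) (s : nat -> nat -> seq (R * R)) :
  (forall i j, (i < j < 5)%N -> last (P i) (s i j) = P j) ->
  (forall i j, (i < j < 5)%N -> P i <> P j) ->
  (forall i j k l, (i < j < 5)%N -> (k < l < 5)%N -> indep i j k l ->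
     all_segs (fun u v => all_segs (seg_disj u v) (P k) (s k l)) (P i) (s i j)) ->
  False.
Proof.
move=> hl hP hs.
apply: (@K5_parity (fun i k l => crossings (P i) (P k) (s k l))
                   (fun i j => ltl (P i) (P j))).
  move=> i j k l ij kl d; apply: addb_even.
  by have := crossings_sym (hs i j k l ij kl d); rewrite !hl.
by move=> i j ij; rewrite (ltl_total (hP _ _ ij)); case: (ltl _ _).
Qed.

End CompleteGraph.

(** * Discrete connectedness by chains of short steps *)

Section Chains.
Variable R : realFieldType.
Implicit Types (u v p q z : R * R) (s : seq (R * R)).

Definition close (e : R) u v := (`|u.1 - v.1| <= e) && (`|u.2 - v.2| <= e).

Lemma closeC e u v : close e u v = close e v u.
Proof. by rewrite /close (distrC u.1) (distrC u.2). Qed.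

Lemma close_refl e u : 0 <= e -> close e u u.
Proof. by move=> e0; rewrite /close !subrr normr0 e0. Qed.

Lemma close_trans d e u v z : close d u v -> close e v z -> close (d + e) u z.
Proof.
move=> /andP[u1 u2] /andP[v1 v2]; rewrite /close.
by apply/andP; split; [apply: le_trans (ler_distD v.1 _ _) (lerD u1 v1) | apply: le_trans (ler_distD v.2 _ _) (lerD u2 v2)].
Qed.

Lemma close_le d e u v : d <= e -> close d u v -> close e u v.
Proof. by move=> de /andP[h1 h2]; rewrite /close (le_trans h1) ?(le_trans h2). Qed.

Lemma on_seg_close e z p q : on_seg z p q -> close e p q ->
  close (e / 2) z p \/ close (e / 2) z q.
Proof.
case=> t /andP[t0 t1] -> /andP[h1 h2].
have e0 : 0 <= e by apply: le_trans h1.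
have scaled (s x : R) : 0 <= s -> s <= 1 / 2 -> `|x| <= e -> `|s * x| <= e / 2.
  by move=> s0 s1 xe; rewrite normrM (ger0_norm s0); have := normr_ge0 x; nra.
have [t2|t2] := leP t (1 / 2).
  left; rewrite /close /= ![_ + t * _ - _]addrAC !subrr !add0r.
  by rewrite !scaled // distrC.
right; rewrite /close /=.
have eq1 (x y : R) : x + t * (y - x) - y = (1 - t) * (x - y) by ring.
by rewrite !eq1 !scaled //; lra.
Qed.

(** A common point would be within [e / 2] of an end of each segment, so these two ends would be
    [e]-close. *)
Lemma far_seg_disj e p q u v : close e p q -> close e u v ->
  ~~ close e p u -> ~~ close e p v -> ~~ close e q u -> ~~ close e q v ->
  seg_disj p q u v.
Proof.
move=> pq uv pu pv qu qv z hz hz'.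
have key a b : close (e / 2) z a -> close (e / 2) z b -> close e a b.
  by rewrite closeC [e in close e a b]splitr; exact: close_trans.
by case: (on_seg_close hz pq) => /key h; case: (on_seg_close hz' uv) => /h;
   apply/negP.
Qed.

(** Only the vertices have to satisfy [Q]; disjointness of the segments is recovered from
    [far_seg_disj]. *)
Definition is_chain (Q : R * R -> Prop) e p s q :=
  [/\ last p s = q, all_segs (fun u v => close e u v) p s
    & forall z, z \in p :: s -> Q z].

Definition reach Q e p q := exists s, is_chain Q e p s q.

Lemma reach_refl (Q : R * R -> Prop) e p : Q p -> reach Q e p p.
Proof. by move=> Qp; exists [::]; split=> // z; rewrite inE => /eqP->. Qed.

Lemma reach_trans Q e p q z : reach Q e p q -> reach Q e q z -> reach Q e p z.
Proof.
case=> s [<- cs Qs] [t [<- ct Qt]]; exists (s ++ t); split.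
- by rewrite last_cat.
- exact: all_segs_cat.
- move=> w; rewrite -cat_cons mem_cat => /orP[/Qs//|wt].
  by apply: Qt; rewrite inE wt orbT.
Qed.

Lemma reach_step (Q : R * R -> Prop) e p q : Q p -> Q q -> close e p q -> reach Q e p q.
Proof.
move=> Qp Qq pq; exists [:: q]; split=> // z.
by rewrite !inE => /orP[]/eqP->.
Qed.

Lemma reach_mono (Q Q' : R * R -> Prop) d e p q : (forall z, Q z -> Q' z) ->
  d <= e -> reach Q d p q -> reach Q' e p q.
Proof.
move=> QQ de [s [h1 h2 h3]]; exists s; split=> // [|z /h3/QQ//].
by apply: all_segs_impl h2 => u v; exact: close_le.
Qed.

Lemma all_segs_in (P : R * R -> R * R -> Prop) Q e p s q : is_chain Q e p s q ->
  (forall u v, Q u -> Q v -> close e u v -> P u v) -> all_segs P p s.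
Proof.
case=> _ + + QP; elim: s p => //= z s IH p [pz zs] Qs; split.
  by apply: QP => //; apply: Qs; rewrite !inE eqxx ?orbT.
by apply: IH => // w ws; apply: Qs; rewrite inE ws orbT.
Qed.

Lemma chain_const (B : eqType) (f : R * R -> B) Q e p q : reach Q e p q ->
  (forall u v, Q u -> Q v -> close e u v -> f u = f v) -> f p = f q.
Proof.
case=> s [<- + +] fQ; elim: s p => //= z s IH p [pz zs] Qs.
rewrite (fQ p z) //; first by apply: IH => // w ws; apply: Qs; rewrite inE ws orbT.
  by apply: Qs; rewrite inE eqxx.
by apply: Qs; rewrite !inE eqxx orbT.
Qed.

End Chains.

(** * Families of curves *)

Section Drawings.
Variable R : realFieldType.
Implicit Types (u v p q z : R * R) (s : seq (R * R)).

Section Families.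
Variables (V : finType) (T : rel V) (F : V -> R * R -> Prop).
(** Curves enter only through discrete forms of connectedness and compactness, so the topology stays
    confined to a later section. *)
Hypothesis T_refl : reflexive T.
Hypothesis F_chain : forall a (e : R) p q, 0 < e -> F a p -> F a q -> reach (F a) e p q.
Hypothesis F_touch : forall a b, T a b -> exists2 p, F a p & F b p.
Hypothesis F_sep : forall a b, ~~ T a b ->
  exists2 e : R, 0 < e & forall p q, F a p -> F b q -> ~~ close e p q.

Definition union_of (A : pred V) p := exists2 a, A a & F a p.

Lemma F_nonempty a : exists p, F a p.
Proof. by have [p ? _] := F_touch (T_refl a); exists p. Qed.

Lemma uniform_sep : exists2 e : R, 0 < e &
  forall a b p q, ~~ T a b -> F a p -> F b q -> ~~ close e p q.
Proof.
suff [e e0 he] : exists2 e : R, 0 < e & forall ab, ab \in enum {: V * V} ->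
    ~~ T ab.1 ab.2 -> forall p q, F ab.1 p -> F ab.2 q -> ~~ close e p q.
  by exists e => // a b p q nab; apply: (he (a, b)); rewrite ?mem_enum.
elim: (enum _) => [|[a b] s [e e0 IH]]; first by exists 1.
have [ab|nab] := boolP (T a b).
  by exists e => // cd; rewrite inE => /orP[/eqP->|/IH//]; rewrite ab.
have [d d0 hd] := F_sep nab.
exists (Num.min d e); first by rewrite lt_min d0.
move=> cd; rewrite inE => /orP[/eqP-> /= _ p q pa qb|/IH h ncd p q pa qb].
  by apply: contra (hd p q pa qb); apply: close_le; rewrite ge_min lexx.
by apply: contra (h ncd p q pa qb); apply: close_le; rewrite ge_min lexx orbT.
Qed.

Lemma reach_path e a (s : seq V) p q : 0 < e -> path T a s -> F a p -> F (last a s) q ->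
  reach (union_of (mem (a :: s))) e p q.
Proof.
move=> e0; elim: s a p => [|b s IH] a p /=.
  move=> _ pa qa; apply: reach_mono (F_chain e0 pa qa) => // z za.
  by exists a => //=; rewrite inE.
case/andP=> /F_touch[z za zb] bs pa qs.
apply: (reach_trans (q := z)).
  apply: reach_mono (F_chain e0 pa za) => // w wa.
  by exists a => //=; rewrite inE eqxx.
apply: reach_mono (IH _ _ bs zb qs) => // w [c /= cs wc].
by exists c => //=; rewrite inE cs orbT.
Qed.

(** A point on each branch curve, and chains along the paths with steps at most the uniform
    separation [e], draw K5 with disjoint independent edges. *)
Lemma no_K5_model (x : nat -> V) (S : nat -> nat -> seq V) :
  (forall i j, (i < j < 5)%N -> path T (x i) (S i j) /\ last (x i) (S i j) = x j) ->
  (forall i j, (i < j < 5)%N -> ~~ T (x i) (x j)) ->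
  (forall i j k l, (i < j < 5)%N -> (k < l < 5)%N -> indep i j k l ->
     forall a b, a \in x i :: S i j -> b \in x k :: S k l -> ~~ T a b) ->
  False.
Proof.
move=> hS hx hT; have [e e0 he] := uniform_sep.
have [P hP] := choice (fun i => F_nonempty (x i)).
have [|s hs] := @choice (nat * nat)%type (seq (R * R)) (fun ij s =>
    (ij.1 < ij.2 < 5)%N ->
    is_chain (union_of (mem (x ij.1 :: S ij.1 ij.2))) e (P ij.1) s (P ij.2)).
  move=> [i j] /=; have [ij|nij] := boolP (i < j < 5)%N; last by exists [::].
  have [pij lij] := hS i j ij.
  have [|s hs] := reach_path (q := P j) e0 pij (hP i); last by exists s.
  by rewrite lij.
apply: (@K5_nonplanar _ P (fun i j => s (i, j))).
- by move=> i j ij; case: (hs (i, j) ij).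
- move=> i j ij Pij; have := he _ _ _ _ (hx i j ij) (hP i) (hP j).
  by rewrite Pij close_refl // ltW.
- move=> i j k l ij kl d.
  apply: (all_segs_in (hs (i, j) ij)) => u v [a /= aS ua] [b /= bS vb] uv.
  apply: (all_segs_in (hs (k, l) kl)) => z w [c /= cS zc] [f /= fS wf] zw.
  by apply: (far_seg_disj uv zw); apply: he; (try eassumption); apply: (hT i j k l).
Qed.
End Families.
End Drawings.

(** * Grid cells and sums modulo 2 *)

Section Squares.
Variable R : realFieldType.
Implicit Types (u v p q z : R * R) (s : seq (R * R)).

(** The half-open range comes from the lexicographic tie-break; consecutive grid edges therefore
    count each abscissa once. *)
Lemma ray_horizontal u (x y h : R) : 0 < h ->
  ray u (x, y) (x + h, y) = (x < u.1 <= x + h) && (u.2 < y).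
Proof.
case: u => a b h0; rewrite /ray /ltl /orient /=.
rewrite subrr !mul0r !subr0 [x + h - x]addrAC subrr add0r pmulr_rlt0 // subr_lt0.
case: (ltgtP x a) => xa; case: (ltgtP a (x + h)) => ah;
  case: (ltgtP b y) => by_ //=; exfalso; lra.
Qed.

Lemma ray_vertical u (x y h : R) : 0 < h -> ray u (x, y) (x, y + h) = false.
Proof.
case: u => a b h0; rewrite /ray /ltl /orient /= subrr !mul0r !sub0r.
case: (ltgtP x a) => xa //=; rewrite xa subrr !mulr0 oppr0 ltxx !andbF //=.
Qed.

(** Vertical sides never count, and a point whose ray meets only the upper side would be [h]-close
    to the corner [(x, y)]. *)
Lemma ray_square u (x y h : R) : 0 < h ->
  ~~ close h (x, y) u -> ~~ close h (x + h, y) u -> ~~ close h (x, y + h) u ->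
  ~~ close h (x + h, y + h) u ->
  ray u (x, y) (x + h, y) (+) ray u (x + h, y) (x + h, y + h) (+)
  ray u (x, y + h) (x + h, y + h) (+) ray u (x, y) (x, y + h) = false.
Proof.
move=> h0 c1 _ _ _; rewrite !ray_vertical // !ray_horizontal // !addbF.
have [/andP[xu ux]|] //= := boolP (x < u.1 <= x + h).
have [yu|uy] := ltP u.2 y; first by rewrite ltr_wpDr // ltW.
rewrite addFb; apply/negP => uy'; case/negP: c1.
by rewrite /close /= !ler_norml; apply/andP; split; lra.
Qed.

Lemma xor_telescope (f : nat -> bool) n :
  \big[addb/false]_(i < n) (f i (+) f i.+1) = f 0%N (+) f n.
Proof.
elim: n => [|n IH]; first by rewrite big_ord0 addbb.
by rewrite big_ord_recr /= IH addbA -[_ (+) f n (+) f n]addbA addbb addbF.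
Qed.

(** A discrete Stokes formula modulo 2: interior edges belong to two cells and cancel. *)
Lemma xor_grid (H V : nat -> nat -> bool) n m :
  (forall i j, (i < n)%N -> (j < m)%N ->
     H i j (+) V i.+1 j (+) H i j.+1 (+) V i j = false) ->
  \big[addb/false]_(i < n) H i 0%N (+) \big[addb/false]_(i < n) H i m =
  \big[addb/false]_(j < m) V 0%N j (+) \big[addb/false]_(j < m) V n j.
Proof.
move=> hc; pose r j := \big[addb/false]_(i < n) H i j.
have row j : (j < m)%N -> r j (+) r j.+1 = V 0%N j (+) V n j.
  move=> jm; rewrite -(xor_telescope (V ^~ j)) -big_split; apply: eq_bigr => i _ /=.
  have := hc i j (ltn_ord i) jm.
  by case: (H i j); case: (V i.+1 j); case: (H i j.+1); case: (V i j).
rewrite -/(r 0%N) -/(r m) -xor_telescope -big_split /=; apply: eq_bigr => j _.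
by apply: row.
Qed.

Lemma xor_square (a b c d w x y z : bool) : w (+) x (+) y (+) z = false ->
  (a (+) b (+) w) (+) (b (+) c (+) x) (+) (d (+) c (+) y) (+) (a (+) d (+) z) = false.
Proof. by case: a; case: b; case: c; case: d; case: w; case: x; case: y; case: z. Qed.

(** Three chains joining [o], [p] and [q] pairwise form a closed curve, along which the end terms
    cancel in pairs. *)
Lemma xor_theta (a a' b b' c c' o p q : bool) : a (+) a' = o (+) p ->
  b (+) b' = o (+) q -> c (+) c' = p (+) q -> a (+) b (+) c = a' (+) b' (+) c'.
Proof.
by case: a; case: a'; case: b; case: b'; case: c; case: c'; case: o; case: p; case: q.
Qed.

End Squares.

(** * Impossibility of havens in the plane *)

Section Haven.
Variables (R : realType) (V : finType) (T : rel V) (F : V -> R * R -> Prop).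
Hypothesis T_refl : reflexive T.
Hypothesis F_chain : forall a (e : R) p q, 0 < e -> F a p -> F a q -> reach (F a) e p q.
Hypothesis F_touch : forall a b, T a b -> exists2 p, F a p & F b p.
Hypothesis F_sep : forall a b, ~~ T a b ->
  exists2 e : R, 0 < e & forall p q, F a p -> F b q -> ~~ close e p q.
Hypothesis F_bounded : exists M : R, forall a p, F a p -> close M p (0, 0).

(** Inside [B k] the label [k] is linked to the root [o], and [K ks] is a component left after
    removing everything that touches the sets [B k]. There are four labels because a grid cell has
    four corners. *)
Variables (o : V) (Z : {set V}) (B : V -> {set V}) (K : seq V -> {set V}).
Hypothesis Z_nonempty : exists k, k \in Z.
Hypothesis B_root : forall k, k \in Z -> o \in B k.
Hypothesis B_conn : forall k, k \in Z -> forall D : {set V}, D \subset B k ->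
  o \in D -> (forall a b, a \in D -> b \in B k -> T a b -> b \in D) -> k \in D.

Definition corner_labels (ks : seq V) := (size ks == 4)%N && all (mem Z) ks.

Hypothesis K_nonempty : forall ks, corner_labels ks -> K ks != finset.set0.
Hypothesis K_sub : forall ks, corner_labels ks -> K ks \subset Z.
Hypothesis K_sep : forall ks a k b, corner_labels ks -> a \in K ks -> k \in ks ->
  b \in B k -> ~~ T a b.
Hypothesis K_conn : forall ks, corner_labels ks -> forall D : {set V},
  D \subset K ks -> D != finset.set0 ->
  (forall a b, a \in D -> b \in K ks -> T a b -> b \in D) -> K ks \subset D.
Hypothesis K_touch : forall ks ks', corner_labels ks -> corner_labels ks' ->
  exists a b, [/\ a \in K ks, b \in K ks' & T a b].

(* Each grid point gets a label [k] and a chain from the root to it along the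
   curves of [B k]. The closed chain through two neighbouring grid points has a
   winding number around the corresponding sets [K ks]; these numbers cancel on
   each cell but add up to one along the boundary, where all labels agree. *)
Lemma no_haven : False.
Proof.
have [e e0 he] := uniform_sep F_sep.
have [M hM] := F_bounded.
have [h h0 eh] : exists2 h : R, 0 < h & e = h + h.
  by exists (e / 2); [rewrite divr_gt0|exact: splitr].
have [Po hPo] := F_nonempty T_refl F_touch o.
have M0 : 0 <= M by have /andP[/= + _] := hM _ _ hPo; apply: le_trans.
(* The grid surrounds all curves; the margin [2 * h] keeps its boundary points from being [h]-close
   to any of them. *)
have [L LE] : exists L, L = M + 2 * h by exists (M + 2 * h).
have [n nL] : exists n, 2 * L < n%:R * h.
  by exists (Num.truncn (2 * L / h)).+1; rewrite -ltr_pdivrMr // truncnS_gt.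
have [g gE] : exists g : nat * nat -> R * R,
    forall i j, g (i, j) = (i%:R * h - L, j%:R * h - L).
  by exists (fun ij => (ij.1%:R * h - L, ij.2%:R * h - L)).
have gSl i j : g (i.+1, j) = ((g (i, j)).1 + h, (g (i, j)).2).
  by rewrite !gE /= -natr1; congr (_, _); ring.
have gSr i j : g (i, j.+1) = ((g (i, j)).1, (g (i, j)).2 + h).
  by rewrite !gE /= -natr1; congr (_, _); ring.
have g_pair p : g p = ((g p).1, (g p).2) by case: (g p).
have shift x : `|x - (x + h)| <= h.
  by rewrite opprD addrA subrr sub0r normrN gtr0_norm.
have close_gl i j : close h (g (i, j)) (g (i.+1, j)).
  by rewrite gSl /close subrr normr0 (ltW h0) andbT; exact: shift.
have close_gr i j : close h (g (i, j)) (g (i, j.+1)).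
  by rewrite gSr /close subrr normr0 (ltW h0); exact: shift.
(* A [clean] point is far from all curves of [Z], an [okp k] point only from those touching nothing
   in [B k]. The latter include all of [K ks] when [k] is in [ks]. *)
pose avoid a p := forall q, F a q -> ~~ close h p q.
pose clean p := forall a, a \in Z -> avoid a p.
pose okp k p := forall a, a \in Z -> (forall b, b \in B k -> ~~ T a b) -> avoid a p.
pose good k p := reach (okp k) h Po p.
have okp_near k b p q : b \in B k -> F b q -> close h q p -> okp k p.
  move=> bB bq qp a aZ anT w aw.
  apply: contra (he _ _ _ _ (anT b bB) aw bq) => pw.
  by rewrite closeC eh; apply: close_trans qp pw.
have okp_on k b q : b \in B k -> F b q -> okp k q.
  by move=> bB bq; apply: okp_near bB bq (close_refl _ (ltW h0)).
have okp_clean k p : clean p -> okp k p by move=> cp a aZ _; apply: cp.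
have good_curve k p : k \in Z -> F k p -> good k p.
  move=> kZ kp.
  pose D := [set b in B k | `[< forall p, F b p -> good k p >]]%SET.
  have : k \in D.
    apply: B_conn => //.
    - by apply/fintype.subsetP => b; rewrite inE => /andP[].
    - rewrite inE B_root //; apply/asboolP => q oq.
      apply: reach_mono (F_chain h0 hPo oq) => // z oz.
      exact: okp_on (B_root kZ) oz.
    - move=> a b; rewrite !inE => /andP[aB /asboolP ha] bB ab.
      rewrite bB; apply/asboolP => q bq.
      have [w aw bw] := F_touch ab.
      apply: (reach_trans (q := w)); first exact: ha.
      by apply: reach_mono (F_chain h0 bw bq) => // z; apply: okp_on.
  by rewrite inE => /andP[_ /asboolP]; apply.
have good_end k p : good k p -> okp k p.
  by case=> s [<- _ hs]; apply: hs; exact: mem_last.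
have good_ext k p q : good k p -> clean q -> close h p q -> good k q.
  move=> gp cq pq; apply: (reach_trans (q := p)) => //.
  by apply: reach_step => //; [exact: good_end | exact: okp_clean].
have BZ k : k \in Z -> k \in B k.
  by move=> kZ; apply: B_conn => //; exact: B_root.
have hit k p q : k \in Z -> F k q -> close h q p -> good k p.
  move=> kZ kq qp; apply: (reach_trans (q := q)); first exact: good_curve.
  by apply: reach_step => //; [exact: okp_on (BZ _ kZ) kq | exact: okp_near (BZ _ kZ) kq qp].
have hit_or_clean p : clean p \/ exists k q, [/\ k \in Z, F k q & close h q p].
  have [cp|ncp] := pselect (clean p); [by left|right].
  move/existsNP: ncp => [k /not_implyP[kZ /existsNP[q /not_implyP[kq /negP]]]].
  by rewrite negbK => pq; exists k, q; rewrite closeC.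
have outer p : L <= `|p.1| \/ L <= `|p.2| -> clean p.
  move=> pL a aZ q /hM /andP[/=]; rewrite !subr0 => q1 q2; apply/negP => /andP[p1 p2].
  by case: pL => [|]; [have := ler_normB p.1 q.1|have := ler_normB p.2 q.2];
    have := ler_distD q.1 p.1 0; have := ler_distD q.2 p.2 0; rewrite LE !subr0; lra.
have L0 : 0 <= L by rewrite LE; lra.
have clean_l j : clean (g (0%N, j)).
  by apply: outer; left; rewrite gE /= mul0r sub0r normrN ger0_norm.
have clean_b i : clean (g (i, 0%N)).
  by apply: outer; right; rewrite gE /= mul0r sub0r normrN ger0_norm.
have nLL : L <= `|n%:R * h - L| by rewrite ger0_norm; lra.
have clean_r j : clean (g (n, j)) by apply: outer; left; rewrite gE.
have clean_t i : clean (g (i, n)) by apply: outer; right; rewrite gE.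
(* Start next to a curve of [Z] and walk left to the boundary, changing the label at each grid point
   that is close to a curve of [Z]. *)
have [k0 [j0 [k0Z good0]]] : exists k j, k \in Z /\ good k (g (0%N, j)).
  have [k kZ] := Z_nonempty; have [q kq] := F_nonempty T_refl F_touch k.
  have idx (x : R) : - M <= x -> exists i : nat, `|x - (i%:R * h - L)| <= h.
    move=> Mx; exists (Num.truncn ((x + L) / h)).
    have /truncn_itv/andP[] : 0 <= (x + L) / h by rewrite divr_ge0 ?(ltW h0) // LE; lra.
    set t := Num.truncn _; rewrite ler_pdivlMr // ltr_pdivrMr // => h1.
    have -> : t.+1%:R = t%:R + 1 :> R by rewrite -natr1.
    by move=> h2; rewrite ler_norml; apply/andP; split; lra.
  have /andP[/= + +] := hM _ _ kq; rewrite !subr0 !ler_norml.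
  move=> /andP[/idx[i hi] _] /andP[/idx[j hj] _].
  have : good k (g (i, j)) by apply: hit kq _ => //; rewrite gE /close hi hj.
  elim: i k kZ {kq hi} => [|i IH] k kZ gk; first by exists k, j.
  have [ci|[k' [q' [kZ' kq' qc']]]] := hit_or_clean (g (i, j)).
    by apply: (IH k) => //; apply: good_ext gk ci _; rewrite closeC.
  by apply: (IH k') => //; apply: hit kq' _.
(* Boundary points are clean, so the single label [k0] extends around the whole boundary. *)
have good_l j : good k0 (g (0%N, j)).
  have down : forall j, good k0 (g (0%N, j)) -> good k0 (g (0%N, 0%N)).
    elim=> // j' IH gj; apply: IH; apply: good_ext gj _ _ => //; by rewrite closeC.
  elim: j => [|j IH]; first exact: down good0.
  exact: good_ext IH _ _.
have good_b i : good k0 (g (i, 0%N)) by elim: i => // i IH; exact: good_ext IH _ _.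
have good_t i : good k0 (g (i, n)) by elim: i => // i IH; exact: good_ext IH _ _.
have good_r j : good k0 (g (n, j)) by elim: j => // j IH; exact: good_ext IH _ _.
have good_ex i j : exists k, k \in Z /\ good k (g (i, j)).
  elim: i => [|i [k [kZ gk]]]; first by exists k0.
  have [ci|[k' [q' [kZ' kq' qc']]]] := hit_or_clean (g (i.+1, j)).
    by exists k; split=> //; exact: good_ext gk _ _.
  by exists k'; split=> //; exact: hit kq' _.
pose bd (p : nat * nat) := [|| p.1 == 0, p.1 == n, p.2 == 0 | p.2 == n]%N.
have [|ks hks] := @choice (nat * nat)%type (V * seq (R * R))%type (fun p ks =>
    [/\ ks.1 \in Z, bd p -> ks.1 = k0 & is_chain (okp ks.1) h Po ks.2 (g p)]).
  move=> [i j]; have [b|nb] := boolP (bd (i, j)).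
    have [s hs] : good k0 (g (i, j)) by case/or4P: b => /eqP /= ->.
    by exists (k0, s).
  have [k [kZ [s hs]]] := good_ex i j.
  by exists (k, s); split=> // b; rewrite b in nb.
pose lab p := (ks p).1; pose pth p := (ks p).2.
have labZ p : lab p \in Z by case: (hks p).
have lab_bd p : bd p -> lab p = k0 by case: (hks p).
have pth_chain p : is_chain (okp (lab p)) h Po (pth p) (g p) by case: (hks p).
pose rho p u := crossings u Po (pth p).
(* The winding number modulo 2 around [u] of the closed chain from [Po] to [g p], across to [g q]
   and back. *)
pose W p q u := rho p u (+) rho q u (+) ray u (g p) (g q).
have W_curve p q a u u' : close h (g p) (g q) -> a \in Z ->
    (forall k b, k \in [:: lab p; lab q] -> b \in B k -> ~~ T a b) ->
    F a u -> F a u' -> W p q u = W p q u'.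
  move=> pq aZ anT au au'; apply: (chain_const (F_chain h0 au au')) => v w av aw vw.
  have turns r : r \in [:: p; q] -> rho r v (+) rho r w = turn v w Po (+) turn v w (g r).
    move=> rpq; have [lst _ _] := pth_chain r; rewrite -[in RHS]lst.
    have anTr b : b \in B (lab r) -> ~~ T a b.
      by apply: anT; move: rpq; rewrite !inE => /orP[]/eqP->; rewrite eqxx ?orbT.
    apply: crossings_turn; apply: (all_segs_in (pth_chain r)) => z z' oz oz' zz'.
    by apply: far_seg_disj vw zz' _ _ _ _; rewrite closeC; [exact: (oz a)|exact: (oz' a)|exact: (oz a)|exact: (oz' a)].
  have lastp r : r \in [:: p; q] -> avoid a (g r).
    move=> rpq; have [lst _ okr] := pth_chain r.
    have : okp (lab r) (g r) by apply: okr; rewrite -lst mem_last.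
    apply=> // b; apply: anT; move: rpq; rewrite !inE => /orP[]/eqP->; by rewrite eqxx ?orbT.
  have tp := turns p (mem_head _ _).
  have tq : rho q v (+) rho q w = turn v w Po (+) turn v w (g q).
    by apply: turns; rewrite !inE eqxx orbT.
  have ap : avoid a (g p) by apply: lastp; rewrite mem_head.
  have aq : avoid a (g q) by apply: lastp; rewrite !inE eqxx orbT.
  have : seg_disj v w (g p) (g q).
    by apply: far_seg_disj vw pq _ _ _ _; rewrite closeC; [exact: ap|exact: aq|exact: ap|exact: aq].
  by move/seg_parity => tr; exact: xor_theta tp tq tr.
have adj_curves p q ks1 : corner_labels ks1 -> lab p \in ks1 -> lab q \in ks1 ->
    close h (g p) (g q) -> forall a u u', a \in K ks1 -> F a u -> F a u' ->
    W p q u = W p q u'.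
  move=> c1 p1 q1 pq a u u' aK au au'; apply: (W_curve _ _ a) au au' => //.
    exact: (fintype.subsetP (K_sub c1)).
  move=> k b; rewrite !inE => /orP[]/eqP-> bB; exact: K_sep c1 aK _ bB.
have W_K p q ks1 a a' u u' : corner_labels ks1 -> lab p \in ks1 -> lab q \in ks1 ->
    close h (g p) (g q) -> a \in K ks1 -> a' \in K ks1 -> F a u -> F a' u' ->
    W p q u = W p q u'.
  move=> c1 p1 q1 pq aK aK' au au'.
  pose D := [set b in K ks1 | `[< forall w, F b w -> W p q u = W p q w >]]%SET.
  have aD : a \in D.
    by rewrite inE aK; apply/asboolP => w aw; exact: (adj_curves p q ks1) au aw.
  have : a' \in D.
    apply: (fintype.subsetP (K_conn c1 _ _ _)) aK'.
    - by apply/fintype.subsetP => b; rewrite inE => /andP[].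
    - by apply/finset.set0Pn; exists a.
    - move=> b c; rewrite !inE => /andP[bK /asboolP hb] cK bc.
      rewrite cK; apply/asboolP => w cw; have [z bz cz] := F_touch bc.
      by rewrite (hb z bz); exact: (adj_curves p q ks1) cz cw.
  by rewrite inE => /andP[_ /asboolP]; apply.
have W_KK p q ks1 ks2 a a' u u' : corner_labels ks1 -> corner_labels ks2 ->
    lab p \in ks1 -> lab q \in ks1 -> lab p \in ks2 -> lab q \in ks2 ->
    close h (g p) (g q) -> a \in K ks1 -> a' \in K ks2 -> F a u -> F a' u' ->
    W p q u = W p q u'.
  move=> c1 c2 p1 q1 p2 q2 pq aK aK' au au'.
  have [b [c [bK cK /F_touch[z bz cz]]]] := K_touch c1 c2.
  by rewrite (W_K p q ks1 a b u z) // (W_K p q ks2 c a' z u').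
have [|pt hpt] := @choice (seq V) (R * R)%type (fun ks1 u =>
    corner_labels ks1 -> exists2 a, a \in K ks1 & F a u).
  move=> ks1; have [c1|nc1] := boolP (corner_labels ks1); last by exists Po.
  have [a aK] := finset.set0Pn _ (K_nonempty c1).
  by have [u au] := F_nonempty T_refl F_touch a; exists u => _; exists a.
pose lab4 p q r s := [:: lab p; lab q; lab r; lab s].
have lab4P p q r s : corner_labels (lab4 p q r s) by rewrite /corner_labels /= !labZ.
(* The value depends on the edge alone. Since components touch, any component avoiding both labels
   gives the same value, so one point can serve the four edges of a cell. *)
pose f p q := W p q (pt (lab4 p q p q)).
have fE p q ks1 a u : corner_labels ks1 -> lab p \in ks1 -> lab q \in ks1 ->
    close h (g p) (g q) -> a \in K ks1 -> F a u -> f p q = W p q u.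
  move=> c1 p1 q1 pq aK au; have [b bK bu] := hpt _ (lab4P p q p q).
  by apply: W_KK bK aK bu au => //; rewrite !inE eqxx ?orbT.
have cells i j : (i < n)%N -> (j < n)%N ->
    f (i, j) (i.+1, j) (+) f (i.+1, j) (i.+1, j.+1) (+) f (i, j.+1) (i.+1, j.+1)
    (+) f (i, j) (i, j.+1) = false.
  move=> _ _; pose ks1 := lab4 (i, j) (i.+1, j) (i.+1, j.+1) (i, j.+1).
  have c1 : corner_labels ks1 by exact: lab4P.
  have [a aK au] := hpt _ c1; set u := pt ks1 in au.
  rewrite !(fE _ _ ks1 a u) ?inE ?eqxx ?orbT //.
  have far p : lab p \in ks1 -> ~~ close h (g p) u.
    move=> pks; have [lst _ okr] := pth_chain p.
    have : okp (lab p) (g p) by apply: okr; rewrite -lst mem_last.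
    apply; [exact: (fintype.subsetP (K_sub c1) a aK)| |exact: au].
    by move=> b; exact: K_sep c1 aK pks.
  have := @ray_square _ u (g (i, j)).1 (g (i, j)).2 h h0.
  rewrite -gSl -gSr -g_pair [((g (i, j)).1 + h, _ + h)](_ : _ = g (i.+1, j.+1)); last first.
    by rewrite gSr gSl.
  move=> rs; have {}rs := rs (far _ _) (far _ _) (far _ _) (far _ _); move: rs.
  rewrite !inE !eqxx !orbT => /(_ isT isT isT isT).
  exact: xor_square.
have := @xor_grid (fun i j => f (i, j) (i.+1, j)) (fun i j => f (i, j) (i, j.+1)) n n cells.
(* One point [u] serves the whole boundary, where all labels are [k0]. Its upward ray meets only the
   top side, once, so the boundary sum is odd. *)
pose k4 := [:: k0; k0; k0; k0].
have c4 : corner_labels k4 by rewrite /corner_labels /= !k0Z.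
have [a aK au] := hpt _ c4; set u := pt k4 in au.
have fbd p q : bd p -> bd q -> close h (g p) (g q) -> f p q = W p q u.
  by move=> /lab_bd p0 /lab_bd q0 pq; apply: (fE p q k4 a) => //; rewrite ?p0 ?q0 inE eqxx.
have /andP[] := hM _ _ au; rewrite !subr0 !ler_norml => /andP[u1 u1'] /andP[u2 u2'].
have rayH i j : ray u (g (i, j)) (g (i.+1, j)) =
    ((g (i, j)).1 < u.1 <= (g (i, j)).1 + h) && (u.2 < (g (i, j)).2).
  by rewrite gSl -ray_horizontal // -g_pair.
have rayV i j : ray u (g (i, j)) (g (i, j.+1)) = false.
  by rewrite gSr -[RHS](@ray_vertical _ u (g (i, j)).1 (g (i, j)).2 h) // -g_pair.
have -> : \big[addb/false]_(i < n) f (i : nat, 0%N) (i.+1, 0%N) =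
    rho (0%N, 0%N) u (+) rho (n, 0%N) u.
  rewrite -(xor_telescope (fun i => rho (i, 0%N) u)); apply: eq_bigr => i _.
  rewrite fbd ?/bd /= ?orbT // /W rayH.
  by rewrite [u.2 < _]lt_gtF ?andbF ?addbF // gE /= LE; lra.
have -> : \big[addb/false]_(i < n) f (i : nat, n) (i.+1, n) =
    ~~ (rho (0%N, n) u (+) rho (n, n) u).
  have l0 : (g (0%N, n)).1 < u.1 by rewrite gE /= LE; lra.
  have ln : ((g (n, n)).1 < u.1) = false.
    by apply/negbTE; rewrite -leNgt gE /= LE; lra.
  have := xor_telescope (fun i => (g (i, n)).1 < u.1) n; rewrite l0 ln => e1.
  rewrite -[RHS]addTb -(xor_telescope (fun i => rho (i, n) u)).
  transitivity (\big[addb/false]_(i < n)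
      (((g (i : nat, n)).1 < u.1) (+) ((g (i.+1, n)).1 < u.1)) (+)
      \big[addb/false]_(i < n) (rho (i : nat, n) u (+) rho (i.+1, n) u)).
    rewrite -big_split; apply: eq_bigr => i _ /=.
    rewrite fbd ?/bd /= ?eqxx ?orbT // /W addbC; congr (_ (+) _).
    rewrite rayH gSl andb_idr; last first.
      by move=> _; rewrite gE /=; lra.
    have [lt1|ge1] /= := ltP (g (i : nat, n)).1 u.1; first by rewrite leNgt.
    by apply/esym/negbTE; rewrite -leNgt; lra.
  by rewrite e1.
have -> : \big[addb/false]_(j < n) f (0%N, j : nat) (0%N, j.+1) =
    rho (0%N, 0%N) u (+) rho (0%N, n) u.
  rewrite -(xor_telescope (fun j => rho (0%N, j) u)); apply: eq_bigr => j _.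
  by rewrite fbd ?/bd /= ?eqxx ?orbT // /W rayV addbF.
have -> : \big[addb/false]_(j < n) f (n, j : nat) (n, j.+1) =
    rho (n, 0%N) u (+) rho (n, n) u.
  rewrite -(xor_telescope (fun j => rho (n, j) u)); apply: eq_bigr => j _.
  by rewrite fbd ?/bd /= ?eqxx ?orbT // /W rayV addbF.
by case: (rho (0%N, 0%N) u); case: (rho (n, 0%N) u); case: (rho (0%N, n) u);
   case: (rho (n, n) u).
Qed.

End Haven.

(** * Compactness and connectedness of curves *)

Section Curves.
Local Open Scope classical_set_scope.
Variable R : realType.
Implicit Types (phi psi : R -> R * R).

(** Compactness as used below: the scales found locally admit a common positive lower bound, which
    works by monotonicity. *)
Lemma unit_interval_uniform (P : R -> R -> Prop) :
  (forall d d' x, d' <= d -> P d x -> P d' x) ->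
  (forall x, 0 <= x <= 1 -> exists2 d, 0 < d &
     forall y, 0 <= y <= 1 -> `|x - y| < d -> P d y) ->
  exists2 d, 0 < d & forall y, 0 <= y <= 1 -> P d y.
Proof.
move=> Pmono Ploc.
have /compact_near_coveringP cov := @segment_compact R 0 1.
have := cov R (0^'+) (fun d x => 0 <= x <= 1 -> P d x) _.
case=> [x|d /= d0 hd].
  rewrite /= in_itv /= => /Ploc[d d0 hd].
  exists (ball x d, [set i | i < d]) => /=.
    by split; [exact: nbhsx_ballx|exact: nbhs_right_lt].
  move=> [y i] /= [xy id] y01; apply: Pmono (ltW id) _.
  by apply: hd => //; exact: xy.
have d20 : 0 < d / 2 by rewrite divr_gt0.
exists (d / 2) => // y y01; apply: (hd (d / 2) _ d20 y _ y01).
  by rewrite /= sub0r normrN gtr0_norm //; lra.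
by rewrite /= in_itv.
Qed.

Definition continuous01 phi := forall x, 0 <= x <= 1 -> forall e, 0 < e ->
  exists2 d, 0 < d &
  forall y, 0 <= y <= 1 -> `|x - y| < d -> close e (phi x) (phi y).

Lemma continuous01P phi : {within `[0, 1], continuous phi} -> continuous01 phi.
Proof.
move=> /subspace_continuousP phic x x01 e e0.
have xI : `[0, 1]%classic x by rewrite /= in_itv.
have /nbhs_ballP[d /= d0 hd] := phic x xI _ (nbhsx_ballx (phi x) e e0).
exists d => // y y01 xy; have [|h1 h2] := hd y xy; first by rewrite /= in_itv.
by rewrite /close !ltW.
Qed.

Lemma uniform_continuous01 phi e : continuous01 phi -> 0 < e ->
  exists2 d, 0 < d & forall x y, 0 <= x <= 1 -> 0 <= y <= 1 ->
    `|x - y| <= d -> close e (phi x) (phi y).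
Proof.
move=> phic e0.
have [||d d0 hd] := @unit_interval_uniform (fun d x => forall y, 0 <= y <= 1 ->
  `|x - y| <= d -> close e (phi x) (phi y)).
- by move=> d d' x d'd h y y01 xy; apply: h => //; exact: le_trans xy d'd.
- move=> x x01; have e20 : 0 < e / 2 by rewrite divr_gt0.
  have [d d0 hd] := phic x x01 _ e20; exists (d / 2); first by rewrite divr_gt0.
  move=> y y01 xy z z01 yz; rewrite [e]splitr.
  apply: close_trans (hd z z01 _).
    by rewrite closeC; apply: hd => //; lra.
  by have := ler_distD y x z; lra.
- by exists d => // x y x01 y01; exact: hd.
Qed.

Definition in_curve phi p := exists2 t, 0 <= t <= 1 & p = phi t.

Lemma curve_chain phi (e : R) p q : continuous01 phi -> 0 < e ->
  in_curve phi p -> in_curve phi q -> reach (in_curve phi) e p q.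
Proof.
move=> phic e0 [s s01 ->] [t t01 ->].
have [d d0 hd] := uniform_continuous01 phic e0.
have [n] : exists n : nat, `|s - t| <= n%:R * d.
  exists (Num.truncn (`|s - t| / d)).+1.
  by rewrite -ler_pdivrMr // ltW // truncnS_gt.
elim: n s s01 => [|n IH] s s01.
  rewrite mul0r normr_le0 subr_eq0 => /eqP->.
  by apply: reach_refl; exists t.
move=> st; have [st1|st1] := leP `|s - t| d.
  by apply: reach_step; [exists s|exists t|exact: hd].
have [u [u01 su ut]] : exists u, [/\ 0 <= u <= 1, `|s - u| <= d & `|u - t| <= n%:R * d].
  have nd : n.+1%:R * d = n%:R * d + d by rewrite -natr1 mulrDl mul1r.
  move: st; rewrite nd => st.
  have [lst|lst] := leP s t.
    move: st st1; rewrite distrC ger0_norm ?subr_ge0 // => st st1; exists (s + d).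
    have -> : s - (s + d) = - d by ring.
    rewrite normrN gtr0_norm //.
    rewrite distrC ger0_norm; last by lra.
    by split; lra.
  move: st st1; rewrite ger0_norm ?subr_ge0 // ?(ltW lst) // => st st1; exists (s - d).
  have -> : s - (s - d) = d by ring.
  rewrite gtr0_norm // ger0_norm; last by lra.
  by split; lra.
apply: (reach_trans (q := phi u)); last exact: IH.
by apply: reach_step; [exists s|exists u|exact: hd].
Qed.

(** Compactness is applied twice: over the parameter [y] for fixed [x], with a neighbourhood of [x]
    built into the property, and then over [x]. *)
Lemma curve_sep phi psi : continuous01 phi -> continuous01 psi ->
  (forall p, in_curve phi p -> in_curve psi p -> False) ->
  exists2 e : R, 0 < e & forall p q, in_curve phi p -> in_curve psi q -> ~~ close e p q.
Proof.
move=> phic psic dis.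
have [||d d0 hd] := @unit_interval_uniform (fun d x => forall y, 0 <= y <= 1 ->
    ~~ close d (phi x) (psi y)); last first.
- by exists d => // p q [s s01 ->] [t t01 ->]; exact: hd.
- move=> x x01.
  have [||d d0 hd] := @unit_interval_uniform (fun d y => forall x', 0 <= x' <= 1 ->
      `|x - x'| < d -> ~~ close d (phi x') (psi y)); last first.
  + by exists d => // x' x'01 xx' y y01; exact: hd.
  + move=> y y01.
    have [e e0 he] : exists2 e, 0 < e & ~~ close e (phi x) (psi y).
      have half (a b : R) : a != b -> 0 < `|a - b| / 2 /\ (`|a - b| <= `|a - b| / 2) = false.
        by rewrite -subr_eq0 -normr_gt0 => ab; split; [lra|apply/negbTE; rewrite -ltNge; lra].
      have [e1|/half[n0 n1]] := eqVneq (phi x).1 (psi y).1; last first.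
        by exists (`|(phi x).1 - (psi y).1| / 2) => //; rewrite /close n1.
      have [e2|/half[n0 n1]] := eqVneq (phi x).2 (psi y).2; last first.
        by exists (`|(phi x).2 - (psi y).2| / 2) => //; rewrite /close n1 andbF.
      exfalso; apply: (dis (phi x)); first by exists x.
      by exists y => //; rewrite [LHS]surjective_pairing e1 e2 -surjective_pairing.
    (* One third each for the move along [phi], the gap between the curves and the move along
       [psi]. *)
    have e30 : 0 < e / 3 by rewrite divr_gt0.
    have [d1 d10 h1] := phic x x01 _ e30; have [d2 d20 h2] := psic y y01 _ e30.
    exists (Num.min (e / 3) (Num.min d1 d2)); first by rewrite !lt_min e30 d10.
    move=> y' y'01; rewrite !lt_min => /andP[_ /andP[_ yy']] x' x'01.
    rewrite !lt_min => /andP[_ /andP[xx' _]].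
    apply: contra he => /(close_le (e := e / 3)) c.
    have -> : e = e / 3 + (e / 3 + e / 3) by field.
    apply: close_trans (h1 x' x'01 xx') _; apply: close_trans (c _) _.
      by rewrite ge_min lexx.
    by rewrite closeC; exact: h2.
  + move=> d d' y dd' h x' x'01 xx'; apply: contra (h x' x'01 (lt_le_trans xx' dd')).
    exact: close_le.
- move=> d d' x dd' h y y01; apply: contra (h y y01); exact: close_le.
Qed.

Lemma curve_bounded phi : continuous01 phi ->
  exists M : R, forall p, in_curve phi p -> close M p (0, 0).
Proof.
move=> phic.
(* Writing the bound as [e^-1] makes the property pass to smaller positive [e]; the second
   alternative covers the remaining values. *)
have [||e e0 he] := @unit_interval_uniform (fun e x => close e^-1 (phi x) (0, 0) \/ e <= 0).
- move=> d d' x dd' [h|d0]; last by right; apply: le_trans d0.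
  have [d'0|d'0] := leP d' 0; [by right|left; apply: close_le h].
  by rewrite lef_pV2 // posrE (lt_le_trans d'0).
- move=> x x01; have [d d0 hd] := phic x x01 _ ltr01.
  pose m := 1 + (`|(phi x).1| + `|(phi x).2|).
  have m0 : 0 < m by rewrite /m; have := normr_ge0 (phi x).1; have := normr_ge0 (phi x).2; lra.
  have cm : close (m - 1) (phi x) (0, 0).
    by rewrite /close /= !subr0 /m addrC addKr lerDl lerDr !normr_ge0.
  exists (Num.min d m^-1); first by rewrite lt_min d0 invr_gt0.
  move=> y y01; rewrite lt_min => /andP[xy _]; left.
  apply: (@close_le _ m).
    by rewrite -[leLHS]invrK lef_pV2 ?posrE ?invr_gt0 ?lt_min ?d0 ?invr_gt0 // ge_min lexx orbT.
  have -> : m = 1 + (m - 1) by ring.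
  by apply: close_trans cm; rewrite closeC; exact: hd.
- exists e^-1 => p [t t01 ->]; case: (he t t01) => //; lra.
Qed.

End Curves.

(** * Combinatorics of touching relations *)

Import mathcomp.boot.fintype mathcomp.boot.finset.
Local Open Scope set_scope.
Local Open Scope ring_scope.

(** Here and in [K5_free], planarity is recorded as a property of the relation alone, so that the
    combinatorial part involves no geometry. *)
Definition haven_free (V : finType) (T : rel V) :=
  forall (o : V) (Z : {set V}) (B : V -> {set V}) (K : seq V -> {set V}),
  (exists k, k \in Z) ->
  (forall k, k \in Z -> o \in B k) ->
  (forall k, k \in Z -> forall D : {set V}, D \subset B k -> o \in D ->
     (forall a b, a \in D -> b \in B k -> T a b -> b \in D) -> k \in D) ->
  (forall ks, corner_labels Z ks -> K ks != set0) ->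
  (forall ks, corner_labels Z ks -> K ks \subset Z) ->
  (forall ks a k b, corner_labels Z ks -> a \in K ks -> k \in ks -> b \in B k ->
     ~~ T a b) ->
  (forall ks, corner_labels Z ks -> forall D : {set V}, D \subset K ks ->
     D != set0 -> (forall a b, a \in D -> b \in K ks -> T a b -> b \in D) ->
     K ks \subset D) ->
  (forall ks ks', corner_labels Z ks -> corner_labels Z ks' ->
     exists a b, [/\ a \in K ks, b \in K ks' & T a b]) ->
  False.

(** * Weighted sets and giant components *)

Section Weights.
Variables (R : realFieldType) (V : finType) (w : V -> R).
Hypothesis w_ge0 : forall v, 0 <= w v.
Implicit Types A B C D S : {set V}.

Definition wt A := \sum_(v in A) w v.

Lemma wt_ge0 A : 0 <= wt A.
Proof. exact: sumr_ge0. Qed.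

Lemma wt0 : wt set0 = 0.
Proof. by rewrite /wt big_set0. Qed.

Lemma wt_split A B : wt A = wt (A :&: B) + wt (A :\: B).
Proof. by rewrite /wt (big_setID B). Qed.

Lemma wt_sub A B : A \subset B -> wt A <= wt B.
Proof.
by move=> /setIidPr AB; rewrite (wt_split B A) AB lerDl wt_ge0.
Qed.

Lemma wt_diff A B : A \subset B -> wt (B :\: A) = wt B - wt A.
Proof. by move=> /setIidPr AB; rewrite (wt_split B A) AB addrC addKr. Qed.

Lemma wt_setU A B : wt (A :|: B) <= wt A + wt B.
Proof.
rewrite (wt_split (A :|: B) A) setUK setDUl setDv set0U lerD2l.
exact/wt_sub/subsetDl.
Qed.

Section Giant.
Variables (T : rel V) (T_sym : symmetric T).

Definition holefree A (d : R) := forall B C, B \subset A -> C \subset A ->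
  d <= wt B -> d <= wt C -> exists b c, [/\ b \in B, c \in C & T b c].

(* A minimal subset of [S] of co-weight less than [d] without links to the rest
   of [S] is connected. *)
Lemma giant_component A S d : holefree A d -> 0 < d -> S \subset A ->
  3 * d <= wt S ->
  exists D, [/\ D \subset S, wt (S :\: D) < d &
    forall D', D' \subset D -> D' != set0 ->
      (forall a b, a \in D' -> b \in D -> T a b -> b \in D') -> D \subset D'].
Proof.
move=> hf d0 SA dS.
pose sep D := [forall a in D, forall b in S :\: D, ~~ T a b].
pose P D := [&& D \subset S, wt (S :\: D) < d & sep D].
have PS : P S.
  rewrite /P subxx setDv wt0 d0; apply/forall_inP => a _; apply/forall_inP => b.
  by rewrite setDv inE.
case: (arg_minnP (fun D : {set V} => #|D|) PS) => D /and3P[DS wD sepD] Dmin.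
exists D; split=> // D' D'D D'0 D'cl.
apply/negPn/negP => nDD'.
(* Such a [D1] is separated from the rest of [S] and has co-weight below [2 * d], hence weight at
   least [d]. Without holes its co-weight is even below [d], against minimality. *)
have no_part D1 : D1 \proper D -> wt (D :\: D1) < d ->
    (forall a b, a \in D1 -> b \in D :\: D1 -> ~~ T a b) -> False.
  move=> /properP[D1D [x xD xD1]] wD1 nT.
  have D1S := subset_trans D1D DS.
  have sep1 : sep D1.
    apply/forall_inP => a aD1; apply/forall_inP => b; rewrite inE => /andP[bD1 bS].
    have [bD|bD] := boolP (b \in D); first by apply: nT; rewrite // inE bD1.
    apply: (forall_inP (forall_inP sepD a (subsetP D1D a aD1))).
    by rewrite inE bD.
  have wSD1 : wt (S :\: D1) = wt (S :\: D) + wt (D :\: D1).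
    by rewrite !wt_diff //; ring.
  have wD1' : d <= wt D1 by have := wt_diff D1S; rewrite wSD1; lra.
  have PD1 : P D1.
    rewrite /P D1S sep1 andbT ltNge; apply/negP => big.
    have [|b [c [bD1 cS]]] := hf _ _ (subset_trans D1S SA) _ wD1' big.
      exact: subset_trans (subsetDl _ _) SA.
    by apply/negP; apply: (forall_inP (forall_inP sep1 b bD1)).
  have := Dmin _ PD1; rewrite leqNgt proper_card //.
  by apply/properP; split=> //; exists x.
have prop : D' \proper D by rewrite properE D'D.
have nT a b : a \in D' -> b \in D :\: D' -> ~~ T a b.
  move=> aD'; rewrite inE => /andP[bD' bD]; apply: contra bD'.
  exact: D'cl.
(* One of [D'] and its complement in [D] is light; the other is then a smaller candidate. *)
have [small|big] := ltP (wt (D :\: D')) d; first exact: no_part prop small nT.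
apply: (no_part (D :\: D')).
- rewrite properE subsetDl; apply: contra D'0 => sub.
  apply/eqP/setP => x; rewrite inE; apply/negbTE/negP => xD'.
  by have := subsetP sub x (subsetP D'D x xD'); rewrite inE xD'.
- have -> : D :\: (D :\: D') = D' by rewrite setDDr setDv set0U; apply/setIidPr.
  rewrite ltNge; apply/negP => big'.
  have [||b [c [bD' cD]]] := hf _ _ _ _ big' big.
  + exact: subset_trans D'D (subset_trans DS SA).
  + exact: subset_trans (subsetDl _ _) (subset_trans DS SA).
  + by apply/negP; exact: nT.
- move=> a b aD; have -> : D :\: (D :\: D') = D' by rewrite setDDr setDv set0U; apply/setIidPr.
  by move=> bD'; rewrite T_sym; exact: nT.
Qed.

End Giant.
End Weights.

(** The budget in units of [d]: [Z] weighs more than 19, contacts with the common root set cost at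
    most 2, and each of four labels costs at most 2 more. Over 9 remain, enough for a giant
    component of weight at least 1, and two such components always touch. *)
Lemma dense_vertex (R : realFieldType) (V : finType) (T : rel V) (w : V -> R)
    (A : {set V}) :
  reflexive T -> symmetric T -> haven_free T -> (forall v, 0 <= w v) ->
  0 < wt w A -> holefree w T A (wt w A / 20) ->
  exists2 x, x \in A & wt w A / 20 <= wt w [set v in A | T x v].
Proof.
move=> Trefl Tsym hav w0 mA hf; set d := wt w A / 20 in hf *.
have d0 : 0 < d by rewrite divr_gt0.
have md : wt w A = 20 * d by rewrite /d; field.
apply: contrapT => nodense.
have small x : x \in A -> wt w [set v in A | T x v] < d.
  by move=> xA; rewrite ltNge; apply/negP => big; apply: nodense; exists x.
pose nb (S : {set V}) := [set v in A | [exists s in S, T s v]].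
have nbA S : nb S \subset A by apply/subsetP => v; rewrite inE => /andP[].
have nb_self (S : {set V}) : S \subset A -> S \subset nb S.
  move=> /subsetP SA; apply/subsetP => v vS; rewrite inE SA //=.
  by apply/exists_inP; exists v.
have nbU x S : x \in A -> wt w (nb (x |: S)) < wt w (nb S) + d.
  move=> xA; apply: le_lt_trans (_ : _ <= wt w (nb S) + wt w [set v in A | T x v]) _.
    apply: le_trans (wt_setU w0 _ _); apply: wt_sub => //; apply/subsetP => v.
    rewrite !inE => /andP[-> /exists_inP[s]]; rewrite !inE => /orP[/eqP->|sS] sv.
      by rewrite sv orbT.
    by apply/orP; left; apply/exists_inP; exists s.
  by rewrite ltrD2l small.
have no_sep (S S' : {set V}) : S \subset A -> S' \subset A -> d <= wt w S -> d <= wt w S' ->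
    (forall s s', s \in S -> s' \in S' -> ~~ T s s') -> False.
  move=> SA SA' dS dS' nT; have [s [s' [sS sS' st]]] := hf _ _ SA SA' dS dS'.
  by have := nT _ _ sS sS'; rewrite st.
(* Growing the root set inside a giant component guarantees that a light connected set can be
   extended. *)
have [|K0 [K0A wK0 K0conn]] := giant_component Tsym hf d0 (subxx A).
  by rewrite md; lra.
have wK0' : 19 * d < wt w K0.
  by have := wt_diff w K0A; rewrite md; lra.
have K0ne : K0 != set0.
  by apply/eqP => e; move: wK0'; rewrite e wt0; lra.
have [r0 rK0] := set0Pn _ K0ne.
pose rooted (X : {set V}) := [/\ r0 \in X, X \subset K0 & forall D : {set V}, D \subset X -> r0 \in D ->
  (forall a b, a \in D -> b \in X -> T a b -> b \in D) -> X \subset D].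
pose P X := `[< rooted X >] && (wt w (nb X) < d).
have Po : P [set r0].
  rewrite /P; apply/andP; split.
    apply/asboolP; split; rewrite ?inE ?sub1set // => D _ oD _; by rewrite sub1set.
  have := nbU r0 set0 (subsetP K0A _ rK0); rewrite setU0.
  suff -> : wt w (nb set0) = 0 by rewrite add0r.
  rewrite -(wt0 w); congr wt; apply/setP => v; rewrite !inE.
  by apply/negbTE; rewrite negb_and; apply/orP; right; apply/exists_inP => -[s]; rewrite inE.
case: (@arg_maxnP _ [set r0] P (fun X : {set V} => #|X|) Po) => X /andP[/asboolP[oX XK0 Xconn] wX] Xmax.
have XA := subset_trans XK0 K0A.
have [x [y [xX yK0 xy yX]]] : exists x y, [/\ x \in X, y \in K0, T x y & y \notin X].
  apply: contrapT => none.
  have : K0 \subset X.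
    apply: K0conn => //; first by apply/set0Pn; exists r0.
    move=> a b aX bK0 ab; apply: contrapT => /negP bX; apply: none; by exists a, b.
  move=> /(wt_sub w0); have := wt_sub w0 (nb_self _ XA); lra.
have yA := subsetP K0A _ yK0.
pose X' := y |: X.
have X'A : X' \subset A by rewrite subUset sub1set yA.
have X'conn (D : {set V}) : r0 \in D -> (forall a b, a \in D -> b \in X' -> T a b -> b \in D) ->
    X' \subset D.
  move=> oD Dcl.
  have XD : X \subset D.
    have : X \subset D :&: X.
      apply: Xconn; rewrite ?subsetIr // ?inE ?oD // => a b; rewrite !inE => /andP[aD aX] bX ab.
      by rewrite bX andbT; apply: (Dcl a) => //; rewrite !inE bX orbT.
    by rewrite subsetI => /andP[].
  rewrite subUset XD andbT sub1set; apply: (Dcl x) => //; first exact: (subsetP XD).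
  by rewrite !inE eqxx.
pose Y := nb X'.
(* By maximality of [X] the added vertex lifts the weight to at least [d]; as its own degree is
   below [d], the weight stays below [2 * d]. *)
have wY : d <= wt w Y.
  rewrite leNgt; apply/negP => wY.
  have PX' : P X'.
    rewrite /P wY andbT; apply/asboolP; split.
    - by rewrite !inE oX orbT.
    - by rewrite subUset sub1set yK0.
    - by move=> D _; exact: X'conn.
  have : (#|X'| <= #|X|)%N := Xmax _ PX'.
  by rewrite /X' cardsU1 yX add1n ltnn.
have wY2 : wt w Y < 2 * d by have := nbU y X yA; rewrite -/X' -/Y; lra.
pose Z := [set k in A | [exists y in Y, T y k]].
have ZA : Z \subset A by apply/subsetP => v; rewrite inE => /andP[].
have wAZ : wt w (A :\: Z) < d.
  rewrite ltNge; apply/negP => big.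
  apply: (no_sep Y (A :\: Z)); rewrite ?nbA ?subsetDl //.
  move=> s s' sY; rewrite !inE => /andP[+ sA']; rewrite sA' /=.
  by apply: contra => ss'; apply/exists_inP; exists s.
have wZ : 19 * d < wt w Z by have := wt_diff w ZA; rewrite md; lra.
pose lnk k := odflt r0 [pick y in Y | T y k].
have lnkP k : k \in Z -> lnk k \in Y /\ T (lnk k) k.
  rewrite inE => /andP[_ /exists_inP[z zY zk]]; rewrite /lnk.
  by case: pickP => [z' /andP[]//|/(_ z)]; rewrite zY zk.
pose B k := lnk k |: (k |: X').
(* Since [Y] is the neighbourhood of [X'], the vertices of [S ks] touch none of the sets [B k] with
   [k] in [ks]. *)
pose S ks := [set v in Z | (v \notin Y) && all (fun k => ~~ T (lnk k) v && ~~ T k v) ks].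
have Sin ks v : (v \in S ks) = [&& v \in Z, v \notin Y
    & all (fun k => ~~ T (lnk k) v && ~~ T k v) ks].
  by rewrite in_set.
have SZ ks : S ks \subset Z by apply/subsetP => v; rewrite Sin => /andP[].
have wS ks : {subset ks <= Z} -> wt w Z - 2 * d - (size ks)%:R * (2 * d) <= wt w (S ks).
  elim: ks => [|k ks IH] ksZ.
    rewrite mul0r subr0 lerBlDr.
    apply: le_trans (_ : wt w (S [::]) + wt w Y <= _); last by rewrite lerD2l ltW.
    apply: le_trans (wt_setU w0 _ _); apply: wt_sub => //.
    by apply/subsetP => v vZ; rewrite in_setU Sin vZ andbT orNb.
  have kZ : k \in Z by apply: ksZ; rewrite mem_head.
  have [lY lk] := lnkP _ kZ.
  have lA := subsetP (nbA _) _ lY; have kA := subsetP ZA _ kZ.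
  have := small _ lA; have := small _ kA.
  have : wt w (S ks) <= wt w (S (k :: ks)) +
      (wt w [set v in A | T (lnk k) v] + wt w [set v in A | T k v]).
    apply: le_trans (_ : wt w (S (k :: ks)) + wt w ([set v in A | T (lnk k) v] :|: [set v in A | T k v]) <= _).
      apply: le_trans (wt_setU w0 _ _); apply: wt_sub => //; apply/subsetP => v vS.
      move: (vS); rewrite Sin => /and3P[vZ vY vks].
      have vA := subsetP ZA _ vZ; rewrite !in_setU Sin vZ vY /= vks !in_set vA /=.
      by case: (T (lnk k) v); case: (T k v).
    by rewrite lerD2l wt_setU.
  have : {subset ks <= Z} by move=> v vks; apply: ksZ; rewrite inE vks orbT.
  move/IH; rewrite /= -natr1 mulrDl mul1r; lra.
have Sbig ks : corner_labels Z ks -> 3 * d <= wt w (S ks) /\ 9 * d < wt w (S ks).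
  move=> /andP[/eqP sz /allP ksZ]; have := wS ks ksZ; rewrite sz; lra.
have [|K hK] := @choice (seq V) {set V} (fun ks D => corner_labels Z ks -> [/\ D \subset S ks,
    wt w (S ks :\: D) < d & forall D' : {set V}, D' \subset D -> D' != set0 ->
      (forall a b, a \in D' -> b \in D -> T a b -> b \in D') -> D \subset D']).
  move=> ks; have [c|nc] := boolP (corner_labels Z ks); last by exists set0.
  have [D hD] := giant_component Tsym hf d0 (subset_trans (SZ ks) ZA) (Sbig ks c).1.
  by exists D.
have wK ks : corner_labels Z ks -> d <= wt w (K ks).
  move=> c; have [KS wSK _] := hK _ c; have [_ ?] := Sbig _ c.
  by have := wt_diff w KS; lra.
have KA ks : corner_labels Z ks -> K ks \subset A.
  by move=> c; have [KS _ _] := hK _ c; apply: subset_trans (subset_trans (SZ ks) ZA).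
apply: (hav r0 Z B K).
- have /set0Pn[k kZ] : Z != set0 by apply/eqP => e; move: wZ; rewrite e wt0; lra.
  by exists k.
- by move=> k _; rewrite /B /X' !in_setU oX !orbT.
- move=> k kZ D DB oD Dcl; have [lY lk] := lnkP _ kZ.
  have X'D : X' \subset D.
    apply: X'conn oD _ => a b aD bX'; apply: Dcl => //.
    by rewrite /B 2!in_setU bX' !orbT.
  have lD : lnk k \in D.
    move: lY; rewrite inE => /andP[_ /exists_inP[s sX' sl]].
    by apply: (Dcl s) => //; [exact: (subsetP X'D)|rewrite /B !inE eqxx].
  by apply: (Dcl (lnk k)) => //; rewrite /B !inE eqxx orbT.
- move=> ks c; apply/eqP => e; have := wK _ c; rewrite e wt0; lra.
- by move=> ks c; have [KS _ _] := hK _ c; apply: subset_trans (SZ ks).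
- move=> ks a k b c aK kks; have [KS _ _] := hK _ c.
  have := subsetP KS _ aK; rewrite Sin => /and3P[aZ aY /allP/(_ k kks)/andP[nl nk]].
  case/setU1P => [->|/setU1P[->|bX']]; rewrite Tsym //.
  apply: contra aY => ba; rewrite in_set (subsetP ZA) //=.
  by apply/exists_inP; exists b.
- by move=> ks c; have [_ _] := hK _ c.
- move=> ks ks' c c'; apply: contrapT => none.
  apply: (no_sep (K ks) (K ks')) (wK _ c) (wK _ c') _; rewrite ?KA // => a b aK bK.
  by apply/negP => ab; apply: none; exists a, b.
Qed.

(** For nonempty [W], the median is the least value of [f] on [W] whose sublevel set carries half of
    the weight. *)
Lemma weighted_median (R : realFieldType) (V : finType) (w f : V -> R) (W : {set V}) :
  (forall v, 0 <= w v) ->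
  exists c, wt w W / 2 <= wt w [set v in W | f v <= c] /\
            wt w W / 2 <= wt w [set v in W | c <= f v].
Proof.
move=> w0; have [->|/set0Pn[z zW]] := eqVneq W set0.
  by exists 0; rewrite wt0 mul0r; split; exact: wt_ge0.
have half : wt w W / 2 <= wt w W by have := wt_ge0 w0 W; lra.
pose P x := (x \in W) && (wt w W / 2 <= wt w [set v in W | f v <= f x]).
have [y yW ymax] : exists2 y, y \in W & forall v, v \in W -> f v <= f y.
  by case: (@Order.TotalTheory.arg_maxP _ _ _ z (mem W) f zW) => y yW ymax; exists y.
have Py : P y.
  rewrite /P yW; suff -> : [set v in W | f v <= f y] = W by [].
  by apply/setP => v; rewrite inE; apply: andb_idr; exact: ymax.
case: (@Order.TotalTheory.arg_minP _ _ _ y P f Py) => x /andP[xW wx] xmin.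
exists (f x); split=> //.
have := wt_split w W [set v | f v < f x].
have -> : W :\: [set v | f v < f x] = [set v in W | f x <= f v].
  by apply/setP => v; rewrite !inE -leNgt andbC.
suff : wt w (W :&: [set v | f v < f x]) <= wt w W / 2 by lra.
have [->|/set0Pn[t]] := eqVneq (W :&: [set v | f v < f x]) set0.
  by rewrite wt0 divr_ge0 // wt_ge0.
rewrite !inE => /andP[tW tx].
pose Q v := (v \in W) && (f v < f x).
have Qt : Q t by rewrite /Q tW.
case: (@Order.TotalTheory.arg_maxP _ _ _ t Q f Qt) => u /andP[uW ux] umax.
rewrite leNgt; apply/negP => big.
have /xmin : P u.
  rewrite /P uW /=; apply: le_trans (ltW big) _; apply: wt_sub => //.
  apply/subsetP => v; rewrite !inE => /andP[vW vx]; rewrite vW /=.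
  by apply: umax; rewrite /Q vW.
by rewrite leNgt ux.
Qed.

Definition K5_free (V : finType) (T : rel V) :=
  forall (x : nat -> V) (S : nat -> nat -> seq V),
  (forall i j, (i < j < 5)%N -> path T (x i) (S i j) /\ last (x i) (S i j) = x j) ->
  (forall i j, (i < j < 5)%N -> ~~ T (x i) (x j)) ->
  (forall i j k l, (i < j < 5)%N -> (k < l < 5)%N -> indep i j k l ->
     forall a b, a \in x i :: S i j -> b \in x k :: S k l -> ~~ T a b) -> False.

(** * Greedy embedding of K5 *)

Section Embedding.
Variables (R : realFieldType) (V : finType) (T : rel V) (mu : 'I_5 -> V -> R).
Hypothesis T_refl : reflexive T.
Hypothesis T_sym : symmetric T.
Hypothesis mu_ge0 : forall i v, 0 <= mu i v.
Implicit Types (W : 'I_5 -> {set V}) (A B : {set V}) (i j k l : 'I_5).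

Definition degree k B u := wt (mu k) [set v in B | T u v].

Definition pair_density i k A B :=
  (\sum_(u in A) mu i u * degree k B u) / (wt (mu i) A * wt (mu k) B).

(** Quantifying over all heavy restrictions lets the bound survive the successive thinnings of the
    embedding. *)
Definition row_bounded (kappa eta : R) :=
  forall W, (forall i, kappa <= wt (mu i) (W i)) ->
  forall k, \sum_(i | i != k) pair_density i k (W i) (W k) <= 1 - eta.

Variables (kappa eta : R).
Hypothesis kappa_gt0 : 0 < kappa.
Hypothesis eta_gt0 : 0 < eta.
Hypothesis eta_le1 : eta <= 1.
Hypothesis rows : row_bounded kappa eta.
Hypothesis touching : forall i j A B, kappa <= wt (mu i) A -> kappa <= wt (mu j) B ->
  exists a b, [/\ a \in A, b \in B & T a b].

Definition upd W i A := fun l => if l == i then A else W l.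

Lemma degree_ge0 k B u : 0 <= degree k B u.
Proof. exact: wt_ge0. Qed.

Lemma pair_density_ge0 i k A B : 0 <= pair_density i k A B.
Proof.
apply: divr_ge0; last by apply: mulr_ge0; exact: wt_ge0.
by apply: sumr_ge0 => u _; apply: mulr_ge0 => //; exact: degree_ge0.
Qed.

Lemma pair_density_lb i k A B c : 0 < wt (mu i) A -> 0 < wt (mu k) B ->
  (forall u, u \in A -> c <= degree k B u) -> c / wt (mu k) B <= pair_density i k A B.
Proof.
move=> A0 B0 hc; rewrite /pair_density ler_pdivlMr ?mulr_gt0 //.
rewrite [leLHS](_ : _ = c * wt (mu i) A); last by field; rewrite !gt_eqF.
rewrite /wt mulr_sumr ler_sum // => u uA.
by rewrite mulrC ler_wpM2l ?hc.
Qed.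

(* Keep the vertices of degree at most the median: the degrees above the medians
   are bounded below by them, so [rows] bounds the sum of the medians. *)
Lemma halve W i j k : (forall i, 2 * kappa <= wt (mu i) (W i)) ->
  i != j -> i != k -> j != k ->
  exists A B, [/\ A \subset W i, B \subset W j,
    wt (mu i) (W i) / 2 <= wt (mu i) A, wt (mu j) (W j) / 2 <= wt (mu j) B
    & forall a b, a \in A -> b \in B ->
      degree k (W k) a + degree k (W k) b <= (1 - eta) * wt (mu k) (W k)].
Proof.
move=> hW ij ik jk; have kap0 := kappa_gt0.
have [c [c1 c2]] := weighted_median (degree k (W k)) (W i) (mu_ge0 i).
have [d [d1 d2]] := weighted_median (degree k (W k)) (W j) (mu_ge0 j).
pose A' := [set v in W i | c <= degree k (W k) v].
pose B' := [set v in W j | d <= degree k (W k) v].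
pose W' := upd (upd W i A') j B'.
have W'i : W' i = A' by rewrite /W' /upd (negbTE ij) eqxx.
have W'j : W' j = B' by rewrite /W' /upd eqxx.
have W'k : W' k = W k by rewrite /W' /upd ![k == _]eq_sym (negbTE ik) (negbTE jk).
have hW' l : kappa <= wt (mu l) (W' l).
  rewrite /W' /upd; case: eqP => [->|_].
    by apply: le_trans d2; have := hW j; lra.
  case: eqP => [->|_]; first by apply: le_trans c2; have := hW i; lra.
  by have := hW l; lra.
have Wk0 : 0 < wt (mu k) (W k) by have := hW k; lra.
have A0 : 0 < wt (mu i) A' by have := hW' i; rewrite W'i; lra.
have B0 : 0 < wt (mu j) B' by have := hW' j; rewrite W'j; lra.
have := rows hW' k; rewrite (bigD1 i) //= (bigD1 j) /=; last by rewrite jk eq_sym.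
rewrite W'i W'j W'k; set rest := \sum_(_ | _) _ => hrow.
have rest0 : 0 <= rest by apply: sumr_ge0 => l _; exact: pair_density_ge0.
have hc : c / wt (mu k) (W k) <= pair_density i k A' (W k).
  by apply: pair_density_lb => // u; rewrite inE => /andP[].
have hd : d / wt (mu k) (W k) <= pair_density j k B' (W k).
  by apply: pair_density_lb => // u; rewrite inE => /andP[].
have cd : c + d <= (1 - eta) * wt (mu k) (W k).
  by rewrite -ler_pdivrMr // mulrDl; lra.
exists [set v in W i | degree k (W k) v <= c], [set v in W j | degree k (W k) v <= d].
split=> //; try by apply/subsetP => v; rewrite inE => /andP[].
by move=> a b; rewrite !inE => /andP[_ ha] /andP[_ hb]; lra.
Qed.

(** Earlier degree bounds survive later halvings: [A] and [B] only shrink, and the sets [W k] are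
    untouched. *)
Lemma halve_all (ks : seq 'I_5) W i j :
  (forall i, 2 ^+ size ks * kappa <= wt (mu i) (W i)) -> i != j ->
  (forall k, k \in ks -> i != k /\ j != k) ->
  exists A B, [/\ A \subset W i, B \subset W j,
    wt (mu i) (W i) / 2 ^+ size ks <= wt (mu i) A,
    wt (mu j) (W j) / 2 ^+ size ks <= wt (mu j) B
    & forall k a b, k \in ks -> a \in A -> b \in B ->
      degree k (W k) a + degree k (W k) b <= (1 - eta) * wt (mu k) (W k)].
Proof.
move=> + ij; have kap0 := kappa_gt0; elim: ks W => [|k ks IH] W hW hks.
  by exists (W i), (W j); rewrite expr0 !divr1; split.
have [ik jk] := hks k (mem_head _ _).
have pow1 : 1 <= 2 ^+ size ks :> R by rewrite exprn_ege1 // ler1n.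
have [|A [B [AW BW wA wB hAB]]] := @halve W i j k _ ij ik jk.
  by move=> l; apply: le_trans (hW l); rewrite /= exprS; nra.
pose W' := upd (upd W i A) j B.
have W'i : W' i = A by rewrite /W' /upd (negbTE ij) eqxx.
have W'j : W' j = B by rewrite /W' /upd eqxx.
have [l|l lks|A2 [B2 [A2W B2W wA2 wB2 hAB2]]] := IH W'.
- rewrite /W' /upd; have := hW; rewrite /= exprS => hW'.
  case: eqP => [->|_]; first by apply: le_trans wB; have := hW' j; lra.
  case: eqP => [->|_]; first by apply: le_trans wA; have := hW' i; lra.
  by have := hW' l; nra.
- by apply: hks; rewrite inE lks orbT.
have pow0 : 0 < 2 ^+ size ks :> R by lra.
exists A2, B2; rewrite W'i in A2W wA2; rewrite W'j in B2W wB2; split.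
- exact: subset_trans AW.
- exact: subset_trans BW.
- apply: le_trans wA2; rewrite /= exprS invfM mulrA ler_pM2r ?invr_gt0 //.
- apply: le_trans wB2; rewrite /= exprS invfM mulrA ler_pM2r ?invr_gt0 //.
- move=> l a b; rewrite inE => /orP[/eqP->|lks] aA bB.
    by apply: hAB; [exact: (subsetP A2W)|exact: (subsetP B2W)].
  have lks' : l \in k :: ks by rewrite inE lks orbT.
  have [il jl] := hks l lks'.
  have := hAB2 l a b lks aA bB.
  by rewrite /W' /upd ![l == _]eq_sym (negbTE il) (negbTE jl).
Qed.

(* Losses per step: 1/64 from six halvings, 1/20 from [dense_vertex], and [eta]
   from avoiding the chosen vertices; there are 5 + 10 steps. *)
Let beta := eta / (64 * 20).
Hypothesis kappa_small : 64 * 20 * kappa <= beta ^+ 15.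
Hypothesis mu_total : forall i, wt (mu i) [set: V] = 1.

Let beta_gt0 : 0 < beta. Proof. by rewrite divr_gt0 ?mulr_gt0 ?ltr0n ?eta_gt0. Qed.
Let beta_le1 : beta <= 1. Proof. have := eta_le1; rewrite /beta; lra. Qed.

Lemma beta_large n : (n <= 15)%N -> 64 * 20 * kappa <= beta ^+ n.
Proof.
by move=> n15; apply: le_trans kappa_small _; apply: ler_wiXn2l => //; apply: ltW.
Qed.

Lemma wt_avoid k B u : degree k B u <= (1 - eta) * wt (mu k) B ->
  eta * wt (mu k) B <= wt (mu k) [set v in B | ~~ T u v].
Proof.
have := wt_split (mu k) B [set v | T u v].
have -> : B :&: [set v | T u v] = [set v in B | T u v] by apply/setP => v; rewrite !inE.
have -> : B :\: [set v | T u v] = [set v in B | ~~ T u v].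
  by apply/setP => v; rewrite !inE andbC.
by rewrite /degree => -> ; lra.
Qed.

Definition others i j := [seq k <- enum 'I_5 | (i != k) && (j != k)].

Lemma othersP i j k : (k \in others i j) = (i != k) && (j != k).
Proof. by rewrite mem_filter mem_enum andbT. Qed.

(** The crude exponent 5, the number of all indices, avoids counting those different from [i] and
    [j]. *)
Lemma pow_others i j : 0 < (2 : R) ^+ size (others i j) <= 32.
Proof.
rewrite exprn_gt0 ?ltr0n //= (_ : 32 = 2 ^+ 5 :> R); last by ring.
by rewrite ler_weXn2l ?ler1n // size_filter (leq_trans (count_size _ _)) // size_enum_ord.
Qed.

Lemma halve_others W i j : (forall l, 32 * kappa <= wt (mu l) (W l)) -> i != j ->
  exists A B, [/\ A \subset W i, B \subset W j,
    wt (mu i) (W i) / 32 <= wt (mu i) A, wt (mu j) (W j) / 32 <= wt (mu j) B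
    & forall k a b, i != k -> j != k -> a \in A -> b \in B ->
      degree k (W k) a + degree k (W k) b <= (1 - eta) * wt (mu k) (W k)].
Proof.
move=> hW ij; have /andP[p0 p32] := pow_others i j; have kap0 := kappa_gt0.
have [l|k|A [B [AW BW wA wB hAB]]] := @halve_all (others i j) W i j _ ij.
- by apply: le_trans (hW l); rewrite ler_pM2r.
- by rewrite othersP => /andP.
exists A, B; split=> //.
- by apply: le_trans wA; rewrite ler_wpM2l ?wt_ge0 // lef_pV2 // posrE ltr0n.
- by apply: le_trans wB; rewrite ler_wpM2l ?wt_ge0 // lef_pV2 // posrE ltr0n.
- by move=> k a b ik jk; apply: hAB; rewrite othersP ik.
Qed.

Lemma positive_nonempty i A : 0 < wt (mu i) A -> exists a, a \in A.
Proof.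
move=> A0; apply/set0Pn/eqP => e; move: A0; by rewrite e wt0 ltxx.
Qed.

(** Pairing [i] with [j] bounds the degrees into every index except [j], at cost 32; one more
    halving with a second partner [j'] treats [j]. The degree of a partner is nonnegative and is
    dropped. *)
Lemma low_degree W i : (forall l, 64 * 20 * kappa <= wt (mu l) (W l)) ->
  exists A, [/\ A \subset W i, wt (mu i) (W i) / 64 <= wt (mu i) A
    & forall k a, k != i -> a \in A -> degree k (W k) a <= (1 - eta) * wt (mu k) (W k)].
Proof.
move=> hW; have kap0 := kappa_gt0.
have [j [j' [ij ij' jj']]] : exists j j' : 'I_5, [/\ i != j, i != j' & j' != j].
  have /existsP[j /existsP[j' /and3P[h1 h2 h3]]] :
      [exists j : 'I_5, exists j' : 'I_5, [&& i != j, i != j' & j' != j]].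
    have : #|[set~ i]| = 4 by rewrite cardsC1 card_ord.
    move=> c; have /card_gt1P[j [j' [h1 h2 h3]]] : (1 < #|[set~ i]|)%N by rewrite c.
    apply/existsP; exists j; apply/existsP; exists j'.
    by move: h1 h2; rewrite !inE ![i == _]eq_sym [j' == j]eq_sym => -> ->.
  by exists j, j'.
have [|A1 [B1 [A1W _ wA1 wB1 h1]]] := @halve_others W i j _ ij.
  by move=> l; have := hW l; lra.
pose W1 := upd W i A1.
have W1i : W1 i = A1 by rewrite /W1 /upd eqxx.
have W1n l : l != i -> W1 l = W l by rewrite /W1 /upd => /negbTE->.
have hWi := hW i; have hWj := hW j; have hWj' := hW j'.
have [|A [B [AW BW wA wB h2]]] := @halve W1 i j' j _ ij' ij jj'.
  move=> l; have [->|li] := eqVneq l i; first by rewrite W1i; lra.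
  by rewrite W1n //; have := hW l; lra.
rewrite W1i in AW wA; rewrite W1n 1?eq_sym // in h2.
rewrite W1n 1?eq_sym // in wB.
have [b1 b1B] : exists b, b \in B1 by apply: (@positive_nonempty j); lra.
have [b bB] : exists b, b \in B by apply: (@positive_nonempty j'); lra.
exists A; split; [exact: subset_trans AW A1W|lra|].
move=> k a ki aA; have [->|kj] := eqVneq k j.
  by have := h2 a b aA bB; have := degree_ge0 j (W j) b; lra.
have := h1 k a b1; rewrite ![_ == k]eq_sym => /(_ ki kj (subsetP AW a aA) b1B).
by have := degree_ge0 k (W k) b1; lra.
Qed.

Hypothesis T_haven : haven_free T.

(** Each center is a vertex of large degree within its own set and low degree into the others. That
    set is then cut down to its neighbours, the other sets to its non-neighbours. *)
Lemma centers (s : seq 'I_5) : uniq s -> (size s <= 5)%N ->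
  exists (x : 'I_5 -> V) W,
    [/\ forall i, beta ^+ size s <= wt (mu i) (W i),
        forall i v, i \in s -> v \in W i -> T (x i) v,
        forall i k v, i \in s -> k != i -> v \in W k -> ~~ T (x i) v
      & forall i k, i \in s -> k \in s -> k != i -> ~~ T (x i) (x k)].
Proof.
elim: s => [|i s IH] /=.
  move=> _ _; have [v _] := @positive_nonempty ord0 [set: V] ltac:(rewrite mu_total; exact: ltr01).
  by exists (fun=> v), (fun=> [set: V]); split=> // i; rewrite mu_total expr0.
move=> /andP[iNs us] s5; have [x [W [hW hin hout hx]]] := IH us (ltnW s5).
have kap0 := kappa_gt0; have eta1 := eta_le1; have eta0 := eta_gt0.
have large l : 64 * 20 * kappa <= wt (mu l) (W l).
  by apply: le_trans (hW l); apply: beta_large; apply: leq_trans (ltnW s5) _.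
have [A [AW wA degA]] := low_degree i large.
have wA0 : 20 * kappa <= wt (mu i) A by have := large i; lra.
have [||z zA wz] := dense_vertex T_refl T_sym T_haven (mu_ge0 i) (A := A); first by lra.
  move=> B C BA CA wB wC; apply: touching; first by apply: le_trans wB; lra.
  by apply: le_trans wC; lra.
have zW := subsetP AW z zA.
have nT k : k \in s -> ~~ T (x k) z.
  by move=> ks; apply: (hout k i) => //; apply: contraNneq iNs => ->.
exists (fun l => if l == i then z else x l).
exists (fun l => if l == i then [set v in A | T z v] else [set v in W l | ~~ T z v]).
split.
- move=> l; rewrite exprS; have := hW l; have [->|li] := eqVneq l i => hl.
    apply: le_trans wz; rewrite /beta.
    have : eta / (64 * 20) * beta ^+ size s <= 1 / (64 * 20) * beta ^+ size s.
      by rewrite ler_wpM2r ?exprn_ge0 ?(ltW beta_gt0) //; lra.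
    by rewrite -/beta; lra.
  apply: le_trans (wt_avoid (degA l z li zA)).
  apply: ler_pM => //; [exact: ltW beta_gt0 | exact/exprn_ge0/ltW/beta_gt0 | rewrite /beta; lra].
- move=> l v; rewrite inE; have [->|li] /= := eqVneq l i; first by rewrite inE => _ /andP[].
  by move=> ls; rewrite inE => /andP[vW _]; apply: hin.
- move=> l k v; rewrite inE; have [->|li] /= := eqVneq l i.
    by move=> _ /negbTE->; rewrite inE => /andP[].
  move=> ls; have [->|ki] := eqVneq k i => kl; rewrite inE => /andP[vA _].
    by apply: (hout l i) => //; exact: (subsetP AW).
  exact: (hout l k).
- move=> l k; rewrite !inE; have [->|li] /= := eqVneq l i; have [->|ki] //= := eqVneq k i.
  + by move=> _ ks _; rewrite T_sym nT.
  + by move=> ls _ _; exact: nT.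
  + exact: hx.
Qed.

Lemma wt_avoid2 k B u v : degree k B u + degree k B v <= (1 - eta) * wt (mu k) B ->
  eta * wt (mu k) B <= wt (mu k) [set x in B | ~~ T u x && ~~ T v x].
Proof.
move=> duv; have := wt_split (mu k) B [set x | T u x || T v x].
have -> : B :&: [set x | T u x || T v x] = [set x in B | T u x] :|: [set x in B | T v x].
  by apply/setP => x; rewrite !inE andb_orr.
have -> : B :\: [set x | T u x || T v x] = [set x in B | ~~ T u x && ~~ T v x].
  by apply/setP => x; rewrite !inE negb_or andbC.
have := wt_setU (mu_ge0 k) [set x in B | T u x] [set x in B | T v x].
by move: duv; rewrite /degree; lra.
Qed.

(** Each edge [i j] gets a touching pair, and the three other sets are thinned to what this pair
    avoids. Later pairs for independent edges are chosen there; edges sharing an index may touch. *)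
Lemma links (W0 : 'I_5 -> {set V}) (s : seq ('I_5 * 'I_5)) :
  (forall i, beta ^+ 5 <= wt (mu i) (W0 i)) ->
  uniq s -> (size s <= 10)%N -> (forall p, p \in s -> p.1 != p.2) ->
  exists (e : 'I_5 * 'I_5 -> V * V) W,
    [/\ forall i, W i \subset W0 i,
        forall i, beta ^+ (5 + size s) <= wt (mu i) (W i),
        forall p, p \in s -> [/\ (e p).1 \in W0 p.1, (e p).2 \in W0 p.2
                                & T (e p).1 (e p).2],
        forall p k v, p \in s -> p.1 != k -> p.2 != k -> v \in W k ->
          ~~ T (e p).1 v /\ ~~ T (e p).2 v
      & forall p q, p \in s -> q \in s -> indep p.1 p.2 q.1 q.2 ->
          forall u v, u \in [:: (e p).1; (e p).2] -> v \in [:: (e q).1; (e q).2] ->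
          ~~ T u v].
Proof.
move=> hW0; have kap0 := kappa_gt0; have eta0 := eta_gt0; have eta1 := eta_le1.
elim: s => [|[i j] s IH] /=.
  move=> _ _ _; have [v _] : exists v, v \in W0 ord0.
    apply: (@positive_nonempty ord0); apply: lt_le_trans (hW0 ord0).
    exact/exprn_gt0/beta_gt0.
  by exists (fun=> (v, v)), W0; split.
move=> /andP[ps us] s10 hs.
have ij : i != j by apply: (hs (i, j)); rewrite mem_head.
have [|e [W [WW0 hW he hout hee]]] := IH us (ltnW s10).
  by move=> p ps'; apply: hs; rewrite inE ps' orbT.
have large l : 64 * 20 * kappa <= wt (mu l) (W l).
  by apply: le_trans (hW l); apply: beta_large; rewrite (leq_add2l 5 _ 10) ltnW.
have [|A [B [AW BW wA wB hAB]]] := @halve_others W i j _ ij.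
  by move=> l; have := large l; lra.
have [||a [b [aA bB ab]]] := @touching i j A B.
- by have := large i; lra.
- by have := large j; lra.
have aW := subsetP AW a aA; have bW := subsetP BW b bB.
exists (fun p => if p == (i, j) then (a, b) else e p).
exists (fun k => if (i == k) || (j == k) then W k
                 else [set v in W k | ~~ T a v && ~~ T b v]).
have sub k v : v \in (if (i == k) || (j == k) then W k
    else [set v in W k | ~~ T a v && ~~ T b v]) -> v \in W k.
  by case: ifP => // _; rewrite inE => /andP[].
have cross q u v : q \in s -> indep i j q.1 q.2 -> u \in [:: a; b] ->
    v \in [:: (e q).1; (e q).2] -> ~~ T v u.
  move=> qs /and4P[iq1 iq2 jq1 jq2]; rewrite !inE => /orP[]/eqP->.
    by have [h1 h2] := hout q i a qs ltac:(by rewrite eq_sym) ltac:(by rewrite eq_sym) aW;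
      case/orP => /eqP->.
  by have [h1 h2] := hout q j b qs ltac:(by rewrite eq_sym) ltac:(by rewrite eq_sym) bW;
      case/orP => /eqP->.
split.
- by move=> k; apply: subset_trans (WW0 k); apply/subsetP => v; exact: sub.
- move=> k; rewrite addnS exprS; have bk : beta * beta ^+ (5 + size s) <= beta ^+ (5 + size s).
    by rewrite ler_piMl ?beta_le1 // exprn_ge0 // ltW ?beta_gt0.
  case: ifP => [_|/negbT]; first by apply: le_trans bk (hW k).
  rewrite negb_or => /andP[ik jk].
  apply: le_trans (wt_avoid2 (hAB k a b ik jk aA bB)).
  apply: ler_pM => //; [exact: ltW beta_gt0 | exact/exprn_ge0/ltW/beta_gt0 | rewrite /beta; lra].
- move=> p; rewrite inE; have [->|pij] //= := eqVneq p (i, j); last exact: he.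
  by move=> _; split=> //; [exact: (subsetP (WW0 i))|exact: (subsetP (WW0 j))].
- move=> p k v; rewrite inE; have [->|pij] /= := eqVneq p (i, j).
    by move=> _ /negbTE-> /negbTE->; rewrite inE => /and3P[].
  by move=> ps' p1 p2 /sub vW; apply: (hout p k).
- move=> p q; rewrite !inE.
  have [->|pij] /= := eqVneq p (i, j); have [->|qij] /= := eqVneq q (i, j).
  + by move=> _ _ /and4P[]; rewrite eqxx.
  + by move=> _ qs ind u v uab vq; rewrite T_sym; exact: (cross q).
  + move=> ps' _ ind u v up vab; apply: (cross p) => //.
    case/and4P: ind => h1 h2 h3 h4.
    by rewrite /indep eq_sym h1 eq_sym h3 eq_sym h2 eq_sym h4.
  + exact: hee.
Qed.

(** An edge of the model is the path center, link, link, center; [centers] uses 5 factors [beta] and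
    [links] the other 10. *)
Lemma not_K5_free : ~ K5_free T.
Proof.
have [|x [W0 [hW0 hin hout hx]]] := centers (enum_uniq 'I_5).
  by rewrite size_enum_ord.
rewrite size_enum_ord in hW0.
pose o5 (n : nat) : 'I_5 := inord n.
have o5E n : (n < 5)%N -> o5 n = n :> nat by move=> n5; rewrite inordK.
have o5_neq m n : (m < 5)%N -> (n < 5)%N -> m != n -> o5 m != o5 n.
  by move=> m5 n5; rewrite -(inj_eq val_inj) /= !o5E.
pose l10 := [:: (0, 1); (0, 2); (0, 3); (0, 4); (1, 2); (1, 3); (1, 4); (2, 3); (2, 4); (3, 4)]%N.
have l10P p : p \in l10 -> (p.1 < p.2 < 5)%N.
  by move=> pl; have /allP/(_ p pl) : all (fun p => p.1 < p.2 < 5)%N l10 by [].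
have l10_lt p : p \in l10 -> (p.1 < 5)%N /\ (p.2 < 5)%N.
  by move/l10P/andP => [h1 h2]; split=> //; exact: ltn_trans h2.
pose prs := [seq (o5 p.1, o5 p.2) | p <- l10].
have mem_prs (i j : nat) : (i < j < 5)%N -> (o5 i, o5 j) \in prs.
  move=> ij; apply/mapP; exists (i, j) => //.
  by move: ij; case: i => [|[|[|[|i]]]]; case: j => [|[|[|[|[|j]]]]] //; rewrite andbF.
have [|||e [W [WW0 hW he hWout hee]]] := @links W0 prs hW0.
- rewrite map_inj_in_uniq // => p q /l10_lt[p1 p2] /l10_lt[q1 q2] [e1 e2].
  move: (congr1 val e1) (congr1 val e2); rewrite /= !o5E //.
  by case: p q {p1 p2 q1 q2 e1 e2} => [? ?] [? ?] /= -> ->.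
- by [].
- move=> p /mapP[q /[dup] /l10_lt[q1 q2] /l10P /andP[q12 _] ->] /=.
  apply: o5_neq => //; by rewrite neq_ltn q12.
move=> K5.
apply: (K5 (fun n => x (o5 n)) (fun m n => [:: (e (o5 m, o5 n)).1; (e (o5 m, o5 n)).2; x (o5 n)])).
- move=> i j ij /=; have [e1 e2 e12] := he _ (mem_prs _ _ ij).
  by rewrite e12 !hin ?mem_enum // T_sym hin ?mem_enum.
- move=> i j /andP[ij j5]; apply: hx; rewrite ?mem_enum //.
  by apply: o5_neq => //; [exact: ltn_trans j5|rewrite gtn_eqF].
- move=> i j k l ij kl /and4P[ik il jk jl] a b.
  have [i5 j5] : (i < 5)%N /\ (j < 5)%N by case/andP: ij => h1 h2; split=> //; exact: ltn_trans h2.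
  have [k5 l5] : (k < 5)%N /\ (l < 5)%N by case/andP: kl => h1 h2; split=> //; exact: ltn_trans h2.
  have [e1 e2 _] := he _ (mem_prs _ _ ij); have [f1 f2 _] := he _ (mem_prs _ _ kl).
  have ind : indep (o5 i, o5 j).1 (o5 i, o5 j).2 (o5 k, o5 l).1 (o5 k, o5 l).2.
    by rewrite /indep /= !o5E // ik il jk.
  have ee := hee _ _ (mem_prs _ _ ij) (mem_prs _ _ kl) ind.
  have xx m n : (m < 5)%N -> (n < 5)%N -> m != n -> ~~ T (x (o5 m)) (x (o5 n)).
    by move=> m5 n5 mn; apply: hx; rewrite ?mem_enum // o5_neq // eq_sym.
  have xw m n v : (m < 5)%N -> (n < 5)%N -> m != n -> v \in W0 (o5 n) -> ~~ T (x (o5 m)) v.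
    by move=> m5 n5 mn; apply: hout; rewrite ?mem_enum // o5_neq // eq_sym.
  rewrite !inE => /or4P[]/eqP-> /or4P[]/eqP->;
   try (by apply: xx => //); try (by apply: (xw _ k) => //); try (by apply: (xw _ l) => //);
   try (by rewrite T_sym; apply: (xw _ i) => //; rewrite eq_sym);
   try (by rewrite T_sym; apply: (xw _ j) => //; rewrite eq_sym);
   by apply: ee; rewrite !inE eqxx ?orbT.
Qed.

End Embedding.

(** * Spread measures of nearly minimal energy *)

Section Scales.
Variables (R : realType) (V : finType) (T : rel V) (U : {set V}).
Hypothesis T_sym : symmetric T.
Implicit Types (a b : V -> R) (mu nu : 'I_5 -> V -> R) (i j k : 'I_5).

Definition form a b := \sum_u a u * \sum_v b v * (T u v)%:R.

(** For positive [s], the cap on the masses forces a support of at least [s] vertices; smaller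
    scales permit more concentrated measures. *)
Definition spread (s : R) a := [/\ forall v, 0 <= a v, forall v, a v <= s^-1,
  forall v, v \notin U -> a v = 0 & \sum_v a v = 1].

(** Ordered pairs are summed, whence the factor 2 in [energy_replace] and the initial bound 20. *)
Definition energy mu := \sum_i \sum_(j | j != i) form (mu i) (mu j).

Definition replace mu k a := fun i => if i == k then a else mu i.

Lemma form_sym a b : form a b = form b a.
Proof.
rewrite /form; under eq_bigr do rewrite mulr_sumr.
rewrite exchange_big /=; apply: eq_bigr => u _; rewrite mulr_sumr.
by apply: eq_bigr => v _; rewrite T_sym; ring.
Qed.

Lemma form_ge0 a b : (forall v, 0 <= a v) -> (forall v, 0 <= b v) -> 0 <= form a b.
Proof.
move=> a0 b0; apply: sumr_ge0 => u _; apply: mulr_ge0 => //.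
by apply: sumr_ge0 => v _; rewrite mulr_ge0.
Qed.

Lemma form_le1 s a b : spread s a -> spread s b -> form a b <= 1.
Proof.
move=> [a0 _ _ a1] [b0 _ _ b1]; rewrite -[leRHS]a1 /form; apply: ler_sum => u _.
apply: ler_piMr => //; rewrite -[leRHS]b1; apply: ler_sum => v _.
by case: (T u v); rewrite ?mulr1 ?mulr0.
Qed.

Lemma form_linear a b b' (c d : R) :
  form a (fun v => c * b v + d * b' v) = c * form a b + d * form a b'.
Proof.
rewrite /form !mulr_sumr -big_split; apply: eq_bigr => u _ /=.
rewrite !mulrA ![_ * a u]mulrC -!mulrA -mulrDr; congr (_ * _).
by rewrite !mulr_sumr -big_split; apply: eq_bigr => v _ /=; ring.
Qed.

Lemma spread_le s s' a : 0 < s' -> s' <= s -> spread s a -> spread s' a.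
Proof.
move=> s'0 ss [h1 h2 h3 h4]; split=> // v; apply: le_trans (h2 v) _.
by rewrite lef_pV2 // posrE (lt_le_trans s'0).
Qed.

Lemma energy_replace mu k a : energy (replace mu k a) =
  \sum_(i | i != k) \sum_(j | (j != i) && (j != k)) form (mu i) (mu j)
  + 2 * \sum_(i | i != k) form (mu i) a.
Proof.
rewrite /energy (bigD1 k) //= /replace eqxx.
rewrite [X in X + _](_ : _ = \sum_(i | i != k) form (mu i) a); last first.
  by apply: eq_bigr => j /negbTE ->; rewrite form_sym.
rewrite [X in _ + X](_ : _ = \sum_(i | i != k) (form (mu i) a +
    \sum_(j | (j != i) && (j != k)) form (mu i) (mu j))); last first.
  apply: eq_bigr => i ik; rewrite (negbTE ik) (bigD1 k) 1?eq_sym //= eqxx.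
  by congr (_ + _); apply: eq_bigr => j /andP[_ /negbTE->].
by rewrite big_split /=; ring.
Qed.

Lemma replace_self mu k : replace mu k (mu k) = mu.
Proof. by apply/funext => i; rewrite /replace; case: eqP => [->|]. Qed.

Variables (kappa s : R).
Hypothesis kappa_gt0 : 0 < kappa.
Hypothesis kappa_half : kappa <= 1 / 2.
Hypothesis s_gt0 : 0 < s.

(* [mu k] is a convex combination of [nu], with coefficient [kappa], and another
   spread measure, for which the energy is at least [L]. *)
Lemma energy_part mu k (nu : V -> R) (L x : R) : (forall i, spread (kappa * s) (mu i)) ->
  spread s (mu k) -> spread (kappa * s) nu -> (forall v, kappa * nu v <= mu k v) ->
  (forall mu', (forall i, spread (kappa * s) (mu' i)) -> L <= energy mu') ->
  energy mu <= L + x -> energy (replace mu k nu) <= L + x / kappa.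
Proof.
move=> hmu hk hnu numu hL hx.
have kap0 := kappa_gt0; have kap1 := kappa_half; have s0 := s_gt0.
have k1 : 0 < 1 - kappa by lra.
pose nu' v := (1 - kappa)^-1 * mu k v + (- kappa / (1 - kappa)) * nu v.
have [mk0 mks mkU mk1] := hk; have [nu0 nus nuU nu1] := hnu.
have hnu' : spread (kappa * s) nu'.
  have eq1 v : nu' v = (mu k v - kappa * nu v) / (1 - kappa) by rewrite /nu'; field; lra.
  split.
  - move=> v; rewrite eq1; apply: divr_ge0; last exact: ltW.
    by rewrite subr_ge0.
  (* Masses grow at most by the factor [(1 - kappa)^-1], which does not exceed [kappa^-1] because
     [kappa <= 1 / 2]. *)
  - move=> v; rewrite eq1 ler_pdivrMr //; apply: (@le_trans _ _ s^-1).
      by apply: le_trans (mks v); rewrite gerBl mulr_ge0 // ltW.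
    rewrite invfM mulrAC ler_peMl ?invr_ge0 ?(ltW s0) //.
    by rewrite mulrC ler_pdivlMr //; lra.
  - by move=> v vU; rewrite eq1 mkU // nuU // mulr0 subr0 mul0r.
  - under eq_bigr do rewrite eq1.
    by rewrite -mulr_suml sumrB mk1 -mulr_sumr nu1 mulr1 divff // gt_eqF.
have hrep : L <= energy (replace mu k nu').
  by apply: hL => i; rewrite /replace; case: eqP.
have := hx; rewrite -[in energy mu](replace_self mu k).
move: hrep; rewrite !energy_replace; set C := \sum_(_ | _) \sum_(_ | _) _.
set Fn' := \sum_(i | i != k) form _ nu'; set Fn := \sum_(i | i != k) form _ nu.
set Fm := \sum_(i | i != k) form _ (mu k).
have -> : Fn' = (1 - kappa)^-1 * Fm + (- kappa / (1 - kappa)) * Fn.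
  rewrite /Fn' /Fm /Fn !mulr_sumr -big_split; apply: eq_bigr => i _.
  exact: form_linear.
move=> h1 h2.
have h3 : (1 - kappa) * L <= (1 - kappa) * C + 2 * (Fm - kappa * Fn).
  rewrite -ler_pdivlMl //; apply: le_trans h1 _.
  by rewrite le_eqVlt; apply/orP; left; apply/eqP; field; lra.
rewrite -(ler_pM2l kap0).
have -> : kappa * (L + x / kappa) = kappa * L + x by field; lra.
lra.
Qed.

Definition restriction (a : V -> R) (W : {set V}) v :=
  if v \in W then a v / wt a W else 0.

Lemma spread_restriction a (W : {set V}) : spread s a -> kappa <= wt a W ->
  spread (kappa * s) (restriction a W) /\ forall v, kappa * restriction a W v <= a v.
Proof.
move=> [a0 a_s aU a1] kW; have kap0 := kappa_gt0; have W0 : 0 < wt a W by lra.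
have s0 := s_gt0.
split; first split.
- by move=> v; rewrite /restriction; case: ifP => // _; rewrite divr_ge0 // ltW.
- move=> v; rewrite /restriction; case: ifP => _; last first.
    by rewrite invr_ge0 mulr_ge0 // ltW.
  rewrite invfM mulrC; apply: ler_pM => //; first by rewrite invr_ge0 ltW.
  by rewrite lef_pV2.
- by move=> v vU; rewrite /restriction aU // mul0r if_same.
- rewrite /restriction -big_mkcond /= -mulr_suml -/(wt a W) divff // gt_eqF //.
move=> v; rewrite /restriction; case: ifP => _; last by rewrite mulr0.
by rewrite mulrA ler_pdivrMr // mulrC ler_wpM2l.
Qed.

Lemma form_restriction a b (A B : {set V}) :
  form (restriction a A) (restriction b B) =
  (\sum_(u in A) a u * wt b [set v in B | T u v]) / (wt a A * wt b B).
Proof.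
rewrite /form mulr_suml [RHS]big_mkcond /=; apply: eq_bigr => u _.
rewrite {1}/restriction; case: ifP => uA; last by rewrite mul0r.
rewrite invfM mulrACA; congr (_ * _).
rewrite /wt [in RHS]big_mkcond /= mulr_suml; apply: eq_bigr => v _.
rewrite /restriction inE; case: (v \in B); rewrite ?mul0r //.
by case: (T u v); rewrite ?mulr1 ?mulr0 ?mul0r.
Qed.

(** Measures are restricted one at a time; each application of [energy_part] divides the allowed
    excess by [kappa]. *)
Lemma energy_restriction mu L x (W : 'I_5 -> {set V}) (ks : seq 'I_5) :
  (forall i, spread s (mu i)) -> (forall i, kappa <= wt (mu i) (W i)) ->
  (forall mu', (forall i, spread (kappa * s) (mu' i)) -> L <= energy mu') ->
  energy mu <= L + x -> 0 <= x -> uniq ks ->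
  let nu i := if i \in ks then restriction (mu i) (W i) else mu i in
  energy nu <= L + x / kappa ^+ size ks.
Proof.
move=> hmu hW hL hx x0; have kap0 := kappa_gt0; have s0 := s_gt0; have kaph := kappa_half.
have ks_s : kappa * s <= s by rewrite ler_piMl ?(ltW s0) //; lra.
elim: ks => [|k ks IH] /=.
  by move=> _; rewrite expr0 divr1.
move=> /andP[kks uks]; have {IH} := IH uks.
set nu := fun i => _; set nu' := fun i => _ => hnu.
have -> : nu' = replace nu k (restriction (mu k) (W k)).
  apply/funext => i; rewrite /nu' /nu /replace inE.
  by have [->|] := eqVneq i k.
rewrite exprSr invfM mulrA.
have sp i : spread (kappa * s) (nu i).
  rewrite /nu; case: ifP => _; first by case: (spread_restriction (hmu i) (hW i)).
  by apply: spread_le ks_s (hmu i); rewrite mulr_gt0.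
have [r1 r2] := spread_restriction (hmu k) (hW k).
apply: energy_part r1 _ hL hnu => //; rewrite /nu (negbTE kks) //.
Qed.

Variable eps : R.
Hypothesis U_gt0 : (0 < #|U|)%N.
Hypothesis s_le : s <= #|U|%:R.
Hypothesis U_deg : forall v, v \in U -> #|[set u in U | T v u]|%:R <= (1 / 4 - eps) * #|U|%:R.

Definition uniform v : R := if v \in U then #|U|%:R^-1 else 0.

Lemma spread_uniform t : 0 < t -> t <= #|U|%:R -> spread t uniform.
Proof.
move=> t0 tU; have N0 : 0 < #|U|%:R :> R by rewrite ltr0n.
split; rewrite /uniform.
- by move=> v; case: ifP => // _; rewrite invr_ge0 ltW.
- by move=> v; case: ifP => _; rewrite ?invr_ge0 ?(ltW t0) // lef_pV2.
- by move=> v /negbTE->.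
- by rewrite -big_mkcond /= sumr_const -[LHS]mulr_natr mulVf // gt_eqF.
Qed.

Lemma form_uniform t a : spread t a -> form a uniform <= 1 / 4 - eps.
Proof.
move=> [a0 _ aU a1]; have -> : 1 / 4 - eps = \sum_v a v * (1 / 4 - eps).
  by rewrite -mulr_suml a1 [RHS]mul1r.
rewrite /form.
apply: ler_sum => u _; have [uU|/aU->] := boolP (u \in U); last by rewrite !mul0r.
have N0 : 0 < #|U|%:R :> R by rewrite ltr0n.
apply: ler_wpM2l => //; apply: le_trans (_ : #|[set v in U | T u v]|%:R / #|U|%:R <= _).
  rewrite /uniform -[#|[set v in U | T u v]|]sum1_card natr_sum mulr_suml [leRHS]big_mkcond /=.
  apply: ler_sum => v _; rewrite inE; case: (v \in U); rewrite ?mul0r //=.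
  by case: (T u v); rewrite ?mulr1 ?mulr0 ?mul1r.
by rewrite ler_pdivrMr // U_deg.
Qed.

(** After all five restrictions the energy exceeds the lower bound by at most [2 * eps]. Exchanging
    measure [k] for the uniform one gives a row of at most [1 - 4 * eps]; since rows count twice in
    the energy, the old row is at most [1 - 3 * eps]. *)
Lemma row_bounded_of_minimal mu : 0 <= eps ->
  (forall i, spread s (mu i)) ->
  (forall mu', (forall i, spread (kappa * s) (mu' i)) ->
     energy mu - 2 * kappa ^+ 5 * eps <= energy mu') ->
  row_bounded T mu kappa (3 * eps).
Proof.
move=> eps0 hmu hL W hW k; have kap0 := kappa_gt0; have s0 := s_gt0; have kaph := kappa_half.
pose nu i := restriction (mu i) (W i).
have k5 : 0 < kappa ^+ 5 by rewrite exprn_gt0.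
have x0 : 0 <= 2 * kappa ^+ 5 * eps by rewrite mulr_ge0 // mulr_ge0 // ltW.
have := energy_restriction hmu hW hL _ x0 (enum_uniq 'I_5).
rewrite subrK lexx size_enum_ord => /(_ isT) /=.
have -> : (fun i => if i \in enum 'I_5 then restriction (mu i) (W i) else mu i) = nu.
  by apply/funext => i; rewrite mem_enum.
have -> : 2 * kappa ^+ 5 * eps / kappa ^+ 5 = 2 * eps by field; lra.
have spn i : spread (kappa * s) (nu i) by case: (spread_restriction (hmu i) (hW i)).
have ks_s : kappa * s <= #|U|%:R by apply: le_trans s_le; rewrite ler_piMl ?(ltW s0) //; lra.
have ks0 : 0 < kappa * s by rewrite mulr_gt0.
have : energy mu - 2 * kappa ^+ 5 * eps <= energy (replace nu k uniform).
  by apply: hL => i; rewrite /replace; case: eqP => // _; exact: spread_uniform.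
rewrite -{2}(replace_self nu k) !energy_replace.
set C := \sum_(_ | _) \sum_(_ | _) _.
have : \sum_(i | i != k) form (nu i) uniform <= \sum_(i : 'I_5 | i != k) (1 / 4 - eps).
  by apply: ler_sum => i _; apply: form_uniform (spn i).
rewrite sumr_const -[X in _ <= X]mulr_natr.
have -> : #|[pred i : 'I_5 | i != k]| = 4%N.
  by rewrite (@eq_card _ _ (predC1 k)) ?cardC1 ?card_ord // => i; rewrite !inE.
have -> : \sum_(i | i != k) pair_density T mu i k (W i) (W k) =
          \sum_(i | i != k) form (nu i) (nu k).
  by apply: eq_bigr => i _; rewrite form_restriction.
lra.
Qed.

End Scales.

Lemma ex_subset_card (V : finType) (A : {set V}) m : (m <= #|A|)%N ->
  exists2 B : {set V}, B \subset A & #|B| = m.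
Proof.
move=> mA; exists [set x in take m (enum A)].
  by apply/subsetP => x; rewrite inE => /mem_take; rewrite mem_enum.
rewrite cardsE; have /card_uniqP -> : uniq (take m (enum A)) by rewrite take_uniq ?enum_uniq.
by rewrite size_takel // -cardE.
Qed.

(* While the energy can drop by [gamma], shrink the scale by [kappa]; the energy
   starts below 20 and stays nonnegative. *)
Lemma scale_exists (R : realType) (kappa eps : R) : 0 < kappa -> kappa <= 1 / 2 ->
  0 < eps -> exists2 sigma : R, 0 < sigma &
  forall (V : finType) (T : rel V) (U : {set V}), symmetric T -> (0 < #|U|)%N ->
    (forall v, v \in U -> #|[set u in U | T v u]|%:R <= (1 / 4 - eps) * #|U|%:R) ->
    exists mu : 'I_5 -> V -> R, (forall i, spread U (sigma * #|U|%:R) (mu i)) /\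
      row_bounded T mu kappa (3 * eps).
Proof.
move=> k0 kh e0; pose gamma := 2 * kappa ^+ 5 * eps.
have g0 : 0 < gamma by rewrite mulr_gt0 // mulr_gt0 // exprn_gt0.
pose N := (Num.truncn (20 / gamma)).+1.
exists (kappa ^+ N) => [|V T U Tsym U0 Udeg]; first by rewrite exprn_gt0.
apply: contrapT => none.
have u0 : 0 < #|U|%:R :> R by rewrite ltr0n.
have pow_gt0 t : 0 < kappa ^+ t * #|U|%:R by rewrite mulr_gt0 ?exprn_gt0.
have k1 : kappa <= 1 by lra.
have descent t : (t <= N)%N -> exists mu : 'I_5 -> V -> R,
    (forall i, spread U (kappa ^+ t * #|U|%:R) (mu i)) /\
    energy T mu <= 20 - t%:R * gamma.
  elim: t => [|t IH] tN.
    exists (fun=> uniform R U); rewrite mul0r subr0 expr0 mul1r.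
    have su := spread_uniform U0 u0 (lexx _); split=> //.
    rewrite /energy [leRHS](_ : _ = \sum_(i < 5) \sum_(j < 5 | j != i) 1).
      by apply: ler_sum => i _; apply: ler_sum => j _; exact: (form_le1 T su).
    under eq_bigr => i _ do rewrite sumr_const (@eq_card _ _ (predC1 i)) ?cardC1 ?card_ord //.
    by rewrite sumr_const card_ord -mulrnA.
  have [mu [hmu emu]] := IH (ltnW tN).
  have [lb|] := pselect (forall mu' : 'I_5 -> V -> R,
    (forall i, spread U (kappa * (kappa ^+ t * #|U|%:R)) (mu' i)) ->
    energy T mu - gamma <= energy T mu').
    exfalso; apply: none; exists mu; split.
      move=> i; apply: spread_le (hmu i) => //.
      by rewrite ler_pM2r // ler_wiXn2l ?(ltW k0) // ltnW.
    apply: (row_bounded_of_minimal Tsym k0 kh (pow_gt0 t) U0 _ Udeg (ltW e0) hmu lb).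
    by rewrite ler_piMl ?(ltW u0) // exprn_ile1 // ltW.
  move=> /existsNP[mu' /not_implyP[hmu' /negP]]; rewrite -ltNge => lt'.
  exists mu'; split; first by rewrite exprS -mulrA.
  have -> : t.+1%:R = t%:R + 1 :> R by rewrite -natr1.
  by rewrite mulrDl mul1r; lra.
have [mu [hmu]] := descent N (leqnn _).
have : 0 <= energy T mu.
  apply: sumr_ge0 => i _; apply: sumr_ge0 => j _; apply: form_ge0.
    by case: (hmu i).
  by case: (hmu j).
have : 20 < N%:R * gamma by rewrite -ltr_pdivrMr // truncnS_gt.
lra.
Qed.

(** With [eta = 3 * eps], the exponent 16 leaves one factor [beta] to absorb [64 * 20]. The cap on
    the masses makes a set of weight [kappa] contain a linear number of vertices, so without holes
    heavy sets touch. *)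
Lemma hole_exists (R : realType) (eps : R) : 0 < eps -> eps <= 1 / 4 ->
  exists2 c : R, 0 < c &
  forall (V : finType) (T : rel V) (U : {set V}), reflexive T -> symmetric T ->
    haven_free T -> K5_free T -> (0 < #|U|)%N ->
    (forall v, v \in U -> #|[set u in U | T v u]|%:R <= (1 / 4 - eps) * #|U|%:R) ->
    exists A B : {set V}, [/\ c * #|U|%:R <= #|A|%:R, c * #|U|%:R <= #|B|%:R
      & forall a b, a \in A -> b \in B -> ~~ T a b].
Proof.
move=> e0 e4; pose beta := 3 * eps / (64 * 20); pose kappa := beta ^+ 16.
have b0 : 0 < beta by rewrite /beta; lra.
have b1 : beta <= 1 / 2 by rewrite /beta; lra.
have k0 : 0 < kappa by rewrite exprn_gt0.
have b15 : beta ^+ 15 <= 1 by rewrite exprn_ile1 //; lra.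
have b15p : 0 < beta ^+ 15 by rewrite exprn_gt0.
have kE : kappa = beta * beta ^+ 15 by rewrite -exprS.
have kh : kappa <= 1 / 2 by rewrite kE; nra.
have ksm : 64 * 20 * kappa <= beta ^+ 15.
  have -> : 64 * 20 * kappa = 3 * eps * beta ^+ 15 by rewrite kE {1}/beta; field.
  by rewrite ler_piMl ?(ltW b15p) //; lra.
have [sigma s0 hs] := scale_exists k0 kh e0.
exists (kappa * sigma) => [|V T U Trefl Tsym hav K5 U0 Udeg]; first by rewrite mulr_gt0.
have [mu [hmu hrow]] := hs V T U Tsym U0 Udeg.
apply: contrapT => none.
have u0 : 0 < #|U|%:R :> R by rewrite ltr0n.
have mu0 i v : 0 <= mu i v by case: (hmu i).
have su0 : 0 < sigma * #|U|%:R by rewrite mulr_gt0.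
have big i (A : {set V}) : kappa <= wt (mu i) A -> kappa * sigma * #|U|%:R <= #|A|%:R.
  move=> kA; rewrite -mulrA -ler_pdivlMr //; apply: le_trans kA _.
  rewrite /wt -[#|A|]sum1_card natr_sum mulr_suml ler_sum // => v _.
  by rewrite mul1r; case: (hmu i).
have eta0 : 0 < 3 * eps by lra.
have eta1 : 3 * eps <= 1 by lra.
apply: (not_K5_free Trefl Tsym mu0 k0 eta0 eta1 hrow _ ksm _ hav) => //.
- move=> i j A B kA kB; apply: contrapT => nT; apply: none; exists A, B.
  split; [exact: big kA|exact: big kB|] => a b aA bB.
  by apply/negP => ab; apply: nT; exists a, b.
- move=> i; case: (hmu i) => _ _ _ <-; apply: eq_bigl => v; by rewrite inE.
Qed.

(** * String graphs *)

Section Graphs.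
Variable G : sgraph.
Implicit Types (v u : vertex G) (U : {set vertex G}).

Definition degree_in U v := #|[set u in U | adj v u]|.

(** Comparing [enum_rank] splits the ordered adjacent pairs into two halves, each mapped injectively
    to edges. *)
Lemma sum_degree_edges : (\sum_v degree_in [set: vertex G] v <= 2 * #|edges G|)%N.
Proof.
pose P := [set p : vertex G * vertex G | adj p.1 p.2].
have -> : (\sum_v degree_in [set: vertex G] v)%N = #|P|.
  rewrite -sum1_card (eq_bigl (fun p => adj p.1 p.2)); last by move=> p; rewrite inE.
  rewrite -(pair_big_dep xpredT (fun v u => adj v u) (fun _ _ => 1%N)) /=.
  by apply: eq_bigr => v _; rewrite sum1_card; apply: eq_card => u; rewrite !inE.
pose f (p : vertex G * vertex G) := [set p.1; p.2].
have half (r : rel (vertex G)) : (forall v u, r v u -> ~~ r u v) ->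
    (#|[set p in P | r p.1 p.2]| <= #|edges G|)%N.
  move=> rasym; rewrite -(@card_in_imset _ _ f).
    apply/subset_leq_card/subsetP => e /imsetP[p]; rewrite !inE => /andP[pP _] ->.
    by apply/imsetP; exists p; rewrite ?inE.
  move=> [a b] [c d]; rewrite !inE /f /= => /andP[_ ab] /andP[_ cd] /setP e.
  have nrr x : r x x -> False by move=> rx; move: (rasym _ _ rx); rewrite rx.
  have /orP ha : (a == c) || (a == d) by have := e a; rewrite !inE eqxx => <-.
  have /orP hb : (b == c) || (b == d) by have := e b; rewrite !inE eqxx orbT => <-.
  case: ha hb => /eqP ha [] /eqP hb; subst a b => //.
  - by case: (nrr _ ab).
  - by move: (rasym _ _ cd); rewrite ab.
  - by case: (nrr _ ab).
pose r v u := (enum_rank v < enum_rank u)%N.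
have r1 := half r; have r2 := half (fun v u => r u v).
rewrite mul2n -addnn; apply: leq_trans (leq_add (r1 _) (r2 _)); first last.
- by move=> v u; rewrite /r -leqNgt => /ltnW.
- by move=> v u; rewrite /r -leqNgt => /ltnW.
apply: leq_trans (leq_card_setU _ _); apply/subset_leq_card/subsetP => p pP.
move: (pP); rewrite !inE => ap; rewrite ap /= /r -neq_ltn.
by apply: contraTneq ap => /val_inj/enum_rank_inj->; rewrite adj_irr.
Qed.

(* [U] maximizes [a |U|^2] minus the sum of the degrees in [U]. *)
Lemma dense_core (R : realType) (a : R) : 0 <= a ->
  exists U, (forall v, v \in U -> (degree_in U v)%:R <= a * #|U|%:R) /\
    a * #|vertex G|%:R ^+ 2 - 2 * #|edges G|%:R <= a * #|U|%:R ^+ 2.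
Proof.
move=> a0; pose D U := \sum_(v in U) (degree_in U v)%:R : R.
pose phi U := a * #|U|%:R ^+ 2 - D U.
have [U _ Umax] := @Order.TotalTheory.arg_maxP _ _ _ [set: vertex G] xpredT phi isT.
exists U; split; last first.
  have := Umax [set: vertex G] isT; rewrite /phi /= cardsT.
  have : 0 <= D U by apply: sumr_ge0.
  have : D [set: vertex G] <= 2 * #|edges G|%:R.
    rewrite /D -natr_sum -natrM ler_nat.
    by apply: leq_trans sum_degree_edges; rewrite leq_eqVlt; apply/orP; left; apply/eqP/eq_bigl => v; rewrite inE.
  lra.
(* Deleting [v] lowers the degree sum by twice its degree and the square term by
   [a * (2 * #|U| - 1)]; maximality compares the two. *)
move=> v vU; have := Umax (U :\ v) isT; rewrite /phi /=.
have adjD v' W : (degree_in W v')%:R = \sum_(u in W) (adj v' u)%:R :> R.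
  rewrite /degree_in -sum1_card natr_sum big_mkcond [RHS]big_mkcond.
  apply: eq_bigr => u _; rewrite inE; case: (u \in W) => //=; by case: adj.
have DE W : D W = \sum_(v' in W) \sum_(u in W) (adj v' u)%:R.
  by apply: eq_bigr => v' _.
have -> : D U = D (U :\ v) + 2 * (degree_in U v)%:R.
  rewrite !DE (big_setD1 v vU) /= -adjD.
  under eq_bigr => v' _ do rewrite (big_setD1 v vU) /=.
  rewrite big_split /= adjD (big_setD1 v vU) /= adj_irr add0r.
  under [X in _ + (X + _)]eq_bigr => v' _ do rewrite adj_sym.
  by ring.
have cU : #|U|%:R = #|U :\ v|%:R + 1 :> R by rewrite (cardsD1 v) vU add1n -natr1.
have c0 : 0 <= #|U :\ v|%:R :> R by [].
rewrite cU; move: (#|U :\ v|%:R) c0 ((degree_in U v)%:R) (D _) => x x0 d z.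
nra.
Qed.

End Graphs.

(** * From string graphs to touching relations, and the conclusion *)

Section StringGraphs.
Variables (R : realType) (G : sgraph).
Hypothesis G_string : string_graph R G.

(** Reflexive closure of adjacency, since a curve meets itself. *)
Definition touch (a b : vertex G) := (a == b) || adj a b.

Lemma touch_refl : reflexive touch.
Proof. by move=> a; rewrite /touch eqxx. Qed.

Lemma touch_sym : symmetric touch.
Proof. by move=> a b; rewrite /touch eq_sym adj_sym. Qed.

Lemma touch_models : haven_free touch /\ K5_free touch.
Proof.
have [F [Fcurve Fadj]] := G_string.
have [phi hphi] : exists phi : vertex G -> R -> R * R, forall a, continuous01 (phi a) /\
    forall p, F a p <-> in_curve (phi a) p.
  have [|phi hphi] := @choice (vertex G) (R -> R * R) (fun a phi => continuous01 phi /\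
    forall p, F a p <-> in_curve phi p); last by exists phi.
  move=> a; have [phi [/continuous01P phic ->]] := Fcurve a; exists phi; split=> // p.
  split=> [[t]|[t t01 ->]].
    by rewrite /= in_itv /= => t01 <-; exists t.
  by exists t => //=; rewrite in_itv.
have phic a : continuous01 (phi a) by case: (hphi a).
pose C a := in_curve (phi a).
have C_chain a (e : R) p q : 0 < e -> C a p -> C a q -> reach (C a) e p q.
  exact: curve_chain.
have C_touch a b : touch a b -> exists2 p, C a p & C b p.
  have [<- _|ab] := eqVneq a b.
    by exists (phi a 0); exists 0; rewrite ?lexx ?ler01.
  rewrite /touch (negbTE ab) /= => /(Fadj a b ab)[p [Fa Fb]].
  by exists p; [apply/(hphi a).2|apply/(hphi b).2].
have C_sep a b : ~~ touch a b ->
    exists2 e : R, 0 < e & forall p q, C a p -> C b q -> ~~ close e p q.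
  rewrite negb_or => /andP[ab nadj]; apply: curve_sep => // p Ca Cb.
  case/negP: nadj; apply/(Fadj a b ab); exists p.
  by split; [apply/(hphi a).2|apply/(hphi b).2].
have C_bounded : exists M : R, forall a p, C a p -> close M p (0, 0).
  have [M hM] := choice (fun a => curve_bounded (phic a)).
  exists (\sum_a `|M a|) => a p /hM; apply: close_le.
  apply: le_trans (ler_norm _) _; rewrite (bigD1 a) //= lerDl.
  exact: sumr_ge0.
split.
  move=> r Z B K h1 h2 h3 h4 h5 h6 h7 h8.
  exact: (no_haven touch_refl C_chain C_touch C_sep C_bounded h1 h2 h3 h4 h5 h6 h7 h8).
move=> x S; exact: (no_K5_model touch_refl C_chain C_touch C_sep).
Qed.

End StringGraphs.

Theorem theorem2 (R : realType) (eps : R) (heps : 0 < eps) :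
  exists2 delta : R, 0 < delta &
    forall (n : nat) (G : sgraph), (1 < n)%N -> #|vertex G| = n ->
      string_graph R G ->
      #|edges G|%:R <= (1 / 4 - eps) * (n%:R ^+ 2 / 2) :> R ->
      exists A B : {set vertex G},
        [/\ [disjoint A & B], #|A| = #|B|, delta * n%:R <= #|A|%:R :> R
          & no_edges_between A B].
Proof.
(* For [eps > 1 / 4] the bound on the number of edges is negative. *)
have [e4|e4] := leP eps (1 / 4); last first.
  exists 1 => // n G n1 nG _ hE; exfalso.
  have E0 : 0 <= #|edges G|%:R :> R by [].
  have n0 : 0 < n%:R ^+ 2 / 2 :> R by rewrite divr_gt0 // exprn_gt0 // ltr0n ltnW.
  have : (1 / 4 - eps) * (n%:R ^+ 2 / 2) < 0 by rewrite nmulr_rlt0 //; lra.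
  by rewrite ltNge (le_trans E0 hE).
(* Half of [eps] pays for passing to the core [U], a quarter for the 1 that reflexivity adds to each
   degree. *)
have e0 : 0 < eps / 4 by lra.
have e1 : eps / 4 <= 1 / 4 by lra.
have [c c0 hc] := hole_exists e0 e1.
(* The first term serves large [n], where [#|U|] is at least [eps * n]; the second makes [delta * n]
   at most 1 for small [n]. *)
exists (Num.min (c * eps) (eps ^+ 2 / 4)).
  by rewrite lt_min mulr_gt0 //= divr_gt0 // exprn_gt0.
move=> n G n1 nG Gstr hE.
have n0 : 0 < n%:R :> R by rewrite ltr0n ltnW.
have n2 : 2 <= n%:R :> R by rewrite ler_nat.
set dl := Num.min _ _.
have hole (A B : {set vertex G}) : dl * n%:R <= #|A|%:R -> dl * n%:R <= #|B|%:R ->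
    (forall a b, a \in A -> b \in B -> ~~ touch a b) ->
    exists A B : {set vertex G}, [/\ [disjoint A & B], #|A| = #|B|,
      dl * n%:R <= #|A|%:R :> R & no_edges_between A B].
  move=> hA hB nT.
  have [A' A'A cA'] := ex_subset_card (geq_minl #|A| #|B|).
  have [B' B'B cB'] := ex_subset_card (geq_minr #|A| #|B|).
  exists A', B'; split; rewrite ?cA' ?cB' //.
  - rewrite disjoint_subset; apply/subsetP => x xA'; rewrite !inE; apply/negP => xB'.
    by have := nT x x (subsetP A'A _ xA') (subsetP B'B _ xB'); rewrite touch_refl.
  - by case: leqP.
  - move=> a b aA bB; have := nT a b (subsetP A'A _ aA) (subsetP B'B _ bB).
    by rewrite negb_or => /andP[].
(* For small [n] one nonadjacent pair suffices; it exists because a complete graph on at least two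
   vertices has too many edges. *)
have [small|large] := leP (n%:R * eps ^+ 2) 4.
  have [a [b [ab nab]]] : exists a b : vertex G, a != b /\ ~~ adj a b.
    apply: contrapT => none.
    have full (v : vertex G) : (degree_in [set: vertex G] v = n.-1)%N.
      rewrite -nG -(cardC1 v); apply: eq_card => u; rewrite !inE /=.
      have [->|uv] := eqVneq u v; first by rewrite adj_irr.
      by apply: contrapT => /negP nadj; apply: none; exists v, u; rewrite eq_sym.
    have := sum_degree_edges G; under eq_bigr => v _ do rewrite full.
    rewrite sum_nat_const nG -(ler_nat R) !natrM.
    have -> : n.-1%:R = n%:R - 1 :> R by rewrite -subn1 natrB // ltnW.
    nra.
  have dl1 : dl * n%:R <= 1.
    apply: le_trans (_ : eps ^+ 2 / 4 * n%:R <= _); last by lra.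
    by rewrite ler_pM2r // ge_min lexx orbT.
  apply: (hole [set a] [set b]); rewrite ?cards1 // => x y.
  by rewrite !inE => /eqP-> /eqP->; rewrite negb_or ab.
have a0 : 0 <= 1 / 4 - eps / 2 by lra.
have [U [Udeg Ubig]] := dense_core G a0; rewrite nG in Ubig.
(* The core inequality gives [eps / 2 * n ^+ 2 <= (1 / 4 - eps / 2) * #|U| ^+ 2], so [#|U| ^+ 2] is
   at least [2 * eps * n ^+ 2]. *)
have Un : eps * n%:R <= #|U|%:R.
  rewrite -(ler_pXn2r (n := 2)) ?nnegrE ?mulr_ge0 ?(ltW n0) ?(ltW heps) //.
  have : 0 <= #|U|%:R ^+ 2 :> R by rewrite exprn_ge0.
  have : 0 <= n%:R ^+ 2 :> R by rewrite exprn_ge0.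
  rewrite exprMn; move: Ubig hE heps e4; clear.
  move: (#|U|%:R ^+ 2) (n%:R ^+ 2) (#|edges G|%:R) => x y z; nra.
have U4 : 4 <= eps * #|U|%:R.
  apply: le_trans (ltW large) _; rewrite mulrC expr2 -mulrA ler_pM2l //.
have U0 : (0 < #|U|)%N.
  rewrite -(ltr0n R); nra.
have [hav K5] := touch_models Gstr.
have [|A [B [hA hB nT]]] := hc _ _ U (@touch_refl G) (@touch_sym G) hav K5 U0.
  move=> v vU; apply: le_trans (_ : (1 + degree_in U v)%:R <= _).
    rewrite ler_nat -(cards1 v); apply: leq_trans (leq_card_setU _ _).
    apply/subset_leq_card/subsetP => u; rewrite !inE => /andP[uU].
    by rewrite /touch uU eq_sym.
  by rewrite natrD; have := Udeg v vU; nra.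
have dlU : dl * n%:R <= c * #|U|%:R.
  apply: le_trans (_ : c * eps * n%:R <= _).
    by rewrite ler_pM2r // ge_min lexx.
  by rewrite -mulrA ler_pM2l.
by apply: (hole A B) => //; apply: le_trans dlU _.
Qed.
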